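(* Let $1<p<q<\infty$. Then: (i) the set $C^1(\mathbb{R}^n)$ of functions having continuous derivatives up to order $1$ is not dense in $NM_p^q(\mathbb{R}^n)$, i.e. the set of elements of $NM_p^q(\mathbb{R}^n)$ that have a $C^1$ representative is not dense in $NM_p^q(\mathbb{R}^n)$; (ii) the set of Lipschitz functions on $\mathbb{R}^n$ is not dense in $NM_p^q(\mathbb{R}^n)$, i.e. the set of elements of $NM_p^q(\mathbb{R}^n)$ that have a Lipschitz representative is not dense in $NM_p^q(\mathbb{R}^n)$.
   Context: Here $X=\mathbb{R}^n$ with the Euclidean distance $d$ and Lebesgue measure $\mu$. Morrey space: for $1\le p\le q<\infty$, $\mathcal{M}_p^q(X)$ is the space of all measurable functions $f$ on $X$ with $$\|f\|_{\mathcal{M}_p^q(X)}:=\sup_{B\subset X}[\mu(B)]^{1/q-1/p}\left[\int_B|f(x)|^p\,d\mu(x)\right]^{1/p}<\infty,$$ the supremum being over all balls $B$ in $X$. Curves: a curve is a continuous mapping from an interval into $X$; it is rectifiable if its length is finite; rectifiable curves are always arc-length parameterized, and $l(\gamma)$ denotes the length of $\gamma$. For a family $\Gamma$ of rectifiable curves, $F(\Gamma)$ is the set of Borel measurable functions $\rho:X\to[0,\infty]$ with $\int_\gamma\rho\,ds\ge 1$ for all $\gamma\in\Gamma$ (so $F(\Gamma)=\emptyset$ if $\Gamma$ contains a constant curve). The Morrey-modulus is $\mathrm{Mod}_p^q(\Gamma):=\inf_{\rho\in F(\Gamma)}\|\rho\|_{\mathcal{M}_p^q(X)}^p$, with $\inf\emptyset=\infty$.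 A non-negative Borel function $g$ is a $\mathrm{Mod}_p^q$-weak upper gradient of a measurable function $f$ if $$|f\circ\gamma(0)-f\circ\gamma(l(\gamma))|\le\int_\gamma g\,ds$$ for all non-constant rectifiable curves $\gamma$ except a family of Morrey-modulus zero. $\widetilde{NM_p^q}(X)$ is the set of measurable $f$ with $\|f\|_{\widetilde{NM_p^q}(X)}:=\|f\|_{\mathcal{M}_p^q(X)}+\inf\|g\|_{\mathcal{M}_p^q(X)}<\infty$, the infimum over all $\mathrm{Mod}_p^q$-weak upper gradients $g$ of $f$. The Newton-Morrey-Sobolev space $NM_p^q(X)$ is the quotient of $\widetilde{NM_p^q}(X)$ by $\{f:\|f\|_{\widetilde{NM_p^q}(X)}=0\}$, with the induced norm. *)

(* Defs.v *)
From HB Require Import structures.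
From mathcomp Require Import all_boot all_order all_algebra.
From mathcomp Require Import all_classical all_reals all_analysis.
From mathcomp Require Import measurable_realfun.

Set Implicit Arguments.
Unset Strict Implicit.
Unset Printing Implicit Defensive.

Import Order.TTheory GRing.Theory Num.Theory.
Import numFieldNormedType.Exports.

Local Open Scope classical_set_scope.
Local Open Scope ring_scope.

(** ** Lebesgue measure on R^n

    The n-fold product of the one-dimensional Lebesgue measure is built on
    n-tuples by recursion on n, transported to row vectors equipped with their
    Borel sigma-algebra, and completed. *)

Section tuple_cons.
Context (R : realType) (n : nat).
Let RT := measurableTypeR R.

Definition tcons (x : RT * n.-tuple RT) : n.+1.-tuple RT :=
  [tuple of x.1 :: x.2].

Definition tuncons (t : n.+1.-tuple RT) : RT * n.-tuple RT :=
  (thead t, [tuple of behead t]).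

Lemma tconsK : cancel tcons tuncons.
Proof. by case=> a t; congr pair; apply/val_inj. Qed.

Lemma measurable_tcons : measurable_fun setT tcons.
Proof. by apply: measurable_cons; [exact: measurable_fst|exact: measurable_snd]. Qed.

Lemma measurable_tuncons : measurable_fun setT tuncons.
Proof.
apply/measurable_fun_pairP; split; first exact: measurable_tnth.
exact: measurable_behead.
Qed.

End tuple_cons.

Section lebesgue_tcons.
Context (R : realType) (n : nat).
Let RT := measurableTypeR R.
Context (m : {sigma_finite_measure set (n.-tuple RT) -> \bar R}).

Definition lebesgue_tcons : set (n.+1.-tuple RT) -> \bar R :=
  pushforward (@lebesgue_measure R \x m)%E (@tcons R n).

Let mf := @measurable_tcons R n.

Let mu0 : lebesgue_tcons set0 = 0%E.
Proof. by rewrite /lebesgue_tcons /pushforward preimage_set0 measure0. Qed.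

Let mu_ge0 A : (0 <= lebesgue_tcons A)%E.
Proof. exact: measure_ge0. Qed.

Let mu_sigma_additive : semi_sigma_additive lebesgue_tcons.
Proof. exact: (measure_semi_sigma_additive (s := pushforward _ _)). Qed.

HB.instance Definition _ := isMeasure.Build _ _ _ lebesgue_tcons
  mu0 mu_ge0 mu_sigma_additive.

Let mu_sigma_finite : sigma_finite setT lebesgue_tcons.
Proof.
have [F FT Ffin] : sigma_finite setT (@lebesgue_measure R \x m)%E.
  have /sigma_finiteP[A [AT ndA Aoo]] := sigma_finiteT (@lebesgue_measure R).
  have /sigma_finiteP[B [BT ndB Boo]] := sigma_finiteT m.
  exists (fun k => A k `*` B k).
    rewrite -setXTT AT BT; apply/seteqP; split=> [[x y] [[i _ Ax] [j _ By]]|].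
      exists (maxn i j) => //; split; [move: Ax|move: By]; apply/subsetPset.
        by apply: ndA; exact: leq_maxl.
      by apply: ndB; exact: leq_maxr.
    by move=> [x y] [i _ [Ax By]]; split; exists i.
  move=> k; have [[mAk Akoo] [mBk Bkoo]] := (Aoo k, Boo k); split.
    exact: measurableX.
  by rewrite product_measure1E// lte_mul_pinfty// ge0_fin_numE.
exists (fun k => @tuncons R n @^-1` F k).
  by rewrite -preimage_bigcup -FT preimage_setT.
move=> k; have [mFk Fk_oo] := Ffin k; split.
  by rewrite -[X in measurable X]setTI; exact: measurable_tuncons.
rewrite /lebesgue_tcons /pushforward -comp_preimage.
by rewrite (_ : _ \o _ = id) ?preimage_id//; apply/funext/tconsK.
Qed.

HB.instance Definition _ := Measure_isSigmaFinite.Build _ _ _ lebesgue_tcons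
  mu_sigma_finite.

End lebesgue_tcons.

Fixpoint lebesgue_tuple (R : realType) (n : nat) :
    {sigma_finite_measure set (n.-tuple (measurableTypeR R)) -> \bar R} :=
  if n is n'.+1 then lebesgue_tcons (lebesgue_tuple R n')
  else \d_ ([tuple] : 0.-tuple (measurableTypeR R)).

Notation borel_rV R n := (g_sigma_algebraType (@open 'rV[R]_n)).

Section tuple_rV.
Context (R : realType) (n : nat).
Let RT := measurableTypeR R.

Definition rV_of_tuple (t : n.-tuple RT) : borel_rV R n :=
  \row_i tnth t i.

Lemma measurable_rV_of_tuple : measurable_fun setT rV_of_tuple.
Proof.
apply: (@measurability _ _ _ (borel_rV R n) _ _ (@open 'rV[R]_n)).
  by [].
move=> _ [U oU <-]; rewrite setTI.
pose B (qk : 'rV[rat]_n * nat) : set 'rV[R]_n :=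
  [set x | forall i, `|ratr (qk.1 0 i) - x 0 i| < qk.2.+1%:R^-1].
pose I := {qk : 'rV[rat]_n * nat | `[< B qk `<=` U >]}.
have -> : U = \bigcup_(qk : I) B (val qk).
  apply/seteqP; split=> [x Ux|x [qk _]]; last by apply: (asboolP _ (valP qk)).
  move: oU; rewrite openE => /(_ _ Ux)/nbhs_ballP[_/posnumP[e] xeU].
  have [k _ /(_ k (leqnn k)) ke] : \forall k \near \oo, k.+1%:R^-1 < e%:num / 2.
    exact: near_infty_natSinv_lt (e%:num / 2)%:pos.
  have k0 : (0 : R) < k.+1%:R^-1 by rewrite invr_gt0.
  pose q : 'rV[rat]_n := \row_i xget 0 [set q : rat |
    `|ratr q - x 0 i| < k.+1%:R^-1].
  have qx i : `|ratr (q 0 i) - x 0 i| < k.+1%:R^-1.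
    rewrite mxE; case: xgetP => // noq.
    have [r] : exists r, ratr r \in `]x 0 i, x 0 i + k.+1%:R^-1[.
      by apply: rat_in_itvoo; rewrite ltrDl.
    rewrite in_itv/= => /andP[xr rx]; case: (noq r) => /=.
    by rewrite ger0_norm ?subr_ge0 ?(ltW xr)// ltrBlDl.
  have qU : `[< B (q, k) `<=` U >].
    apply/asboolP => y Bqky; apply: xeU; split=> // i j.
    rewrite ord1 /ball/= (le_lt_trans (ler_distD (ratr (q 0 j)) _ _))//.
    rewrite [ltRHS]splitr ltrD//; last exact: lt_trans (Bqky j) ke.
    by rewrite distrC; exact: lt_trans (qx j) ke.
  by exists (exist _ (q, k) qU).
rewrite preimage_bigcup; apply: countable_bigcupT_measurable; first exact: countableP.
case=> -[q k] /= _.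
rewrite (_ : _ @^-1` _ = \bigcap_(i in [set` enum 'I_n])
    ((fun t : n.-tuple RT => tnth t i) @^-1` ball (ratr (q 0 i) : R) k.+1%:R^-1)).
  rewrite bigcap_seq; apply: bigsetI_measurable => i _.
  rewrite -[X in measurable X]setTI.
  by apply: measurable_tnth => //; rewrite ball_itv; exact: measurable_itv.
apply/seteqP; split=> [t Bt i _|t Bt i]; first by have := Bt i; rewrite mxE.
by have := Bt i; rewrite /= mem_enum mxE; apply.
Qed.
End tuple_rV.

Section lebesgue_rV.
Context (R : realType) (n : nat).

Definition borel_lebesgue : set (borel_rV R n) -> \bar R :=
  pushforward (lebesgue_tuple R n) (@rV_of_tuple R n).

Let mf := @measurable_rV_of_tuple R n.

Let mu0 : borel_lebesgue set0 = 0%E.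
Proof. by rewrite /borel_lebesgue /pushforward preimage_set0 measure0. Qed.

Let mu_ge0 A : (0 <= borel_lebesgue A)%E.
Proof. exact: measure_ge0. Qed.

Let mu_sigma_additive : semi_sigma_additive borel_lebesgue.
Proof. exact: (measure_semi_sigma_additive (s := pushforward _ _)). Qed.

HB.instance Definition _ := isMeasure.Build _ _ _ borel_lebesgue
  mu0 mu_ge0 mu_sigma_additive.

End lebesgue_rV.

(** Since [borel_lebesgue] is sigma-finite, the Caratheodory measurable sets
    are exactly the Lebesgue measurable ones. *)
Notation lebesgue_rV R n := (caratheodory_type (mu_ext (@borel_lebesgue R n))).

Definition lebesgue_n (R : realType) (n : nat) :
    {measure set (lebesgue_rV R n) -> \bar R} :=
  @completed_measure_extension _ (borel_rV R n) R (@borel_lebesgue R n).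

(** ** Euclidean geometry and curves *)

(** The norm of the library on 'rV[R]_n is the max-norm; the Euclidean distance
    induces the same topology. *)
Definition edist (R : realType) (n : nat) (x y : 'rV[R]_n) : R :=
  Num.sqrt (\sum_i (x 0 i - y 0 i) ^+ 2).

Definition eball (R : realType) (n : nat) (x : 'rV[R]_n) (r : R) :
  set 'rV[R]_n := [set y | edist x y < r].

Section curves.
Context (R : realType) (n : nat).
Local Notation X := 'rV[R]_n.

(** Length of the polygonal line inscribed in c with vertices at the points of
    the partition a < s_0 < ... < b. *)
Definition inscribed_length (c : R -> X) (a b : R) (s : seq R) : R :=
  let F := c \o nth b (a :: s) in
  \sum_(0 <= k < size s) edist (F k) (F k.+1).

Definition curve_length (c : R -> X) (a b : R) : \bar R :=
  ereal_sup [set (inscribed_length c a b s)%:E | s in itv_partition a b].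

(** Rectifiable curves come with their arc-length parameterization
    [0, l(c)] -> X; the values of [rcurve_fun] outside of [0, l(c)] are
    irrelevant. The last field with t = l(c) says that l(c) is the length
    of the curve, which is thus finite. *)
Record rcurve := RCurve {
  rcurve_len : R ;
  rcurve_fun :> R -> X ;
  rcurve_len_ge0 : 0 <= rcurve_len ;
  rcurve_continuous : {within `[0, rcurve_len], continuous rcurve_fun} ;
  rcurve_arc_length : forall t, t \in `[0, rcurve_len] ->
    curve_length rcurve_fun 0 t = t%:E }.

Definition nonconstant (c : rcurve) : Prop :=
  exists s t, [/\ s \in `[0, rcurve_len c], t \in `[0, rcurve_len c] &
                  c s <> c t].

Definition line_integral (c : rcurve) (rho : X -> \bar R) : \bar R :=
  (\int[lebesgue_measure]_(t in `[0%R, rcurve_len c]) rho (c t))%E.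

Definition borel_nonneg (rho : X -> \bar R) : Prop :=
  measurable_fun setT (rho : borel_rV R n -> \bar R) /\ forall x, (0 <= rho x)%E.

End curves.

(** ** Morrey and Newton-Morrey-Sobolev spaces *)

Section newton_morrey.
Context (R : realType) (n : nat) (p q : R).
Local Notation X := 'rV[R]_n.
Implicit Types (f : X -> R) (g rho : X -> \bar R).

Definition morrey_norm g : \bar R :=
  ereal_sup [set (poweR (@lebesgue_n R n (eball x r)) (q^-1 - p^-1) *
                  poweR (\int[@lebesgue_n R n]_(y in eball x r)
                           poweR `|g y| p) p^-1)%E
            | x in [set: X] & r in [set r : R | 0 < r]].

Definition admissible (Gamma : set (rcurve R n)) : set (X -> \bar R) :=
  [set rho | borel_nonneg rho /\
             forall c, Gamma c -> (1 <= line_integral c rho)%E].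

Definition morrey_modulus (Gamma : set (rcurve R n)) : \bar R :=
  ereal_inf [set poweR (morrey_norm rho) p | rho in admissible Gamma].

Definition weak_upper_gradient f g : Prop :=
  borel_nonneg g /\
  exists2 Gamma : set (rcurve R n), morrey_modulus Gamma = 0%E &
    forall c, nonconstant c -> ~ Gamma c ->
      (`|f (c 0) - f (c (rcurve_len c))|%:E <= line_integral c g)%E.

Definition preNM_norm f : \bar R :=
  (morrey_norm (EFin \o f) +
   ereal_inf [set morrey_norm g | g in weak_upper_gradient f])%E.

Definition preNM : set (X -> R) :=
  [set f | measurable_fun setT (f : lebesgue_rV R n -> R) /\
           (preNM_norm f < +oo)%E].

(** Elements of the quotient are equivalence classes, i.e. sets of functions. *)
Definition NM_class f : set (X -> R) :=
  [set h | preNM h /\ preNM_norm (f \- h) = 0%E].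

Definition NM : set (set (X -> R)) := [set NM_class f | f in preNM].

(** Induced norm of A - B, for A and B in NM; the infimum is over
    representatives, on which the seminorm is constant. *)
Definition NM_dist (A B : set (X -> R)) : \bar R :=
  ereal_inf [set preNM_norm (f \- h) | f in A & h in B].

Definition NM_having (C : set (X -> R)) : set (set (X -> R)) :=
  [set A | NM A /\ exists2 f, A f & C f].

Definition NM_dense (D : set (set (X -> R))) : Prop :=
  forall A, NM A -> forall e : R, 0 < e ->
    exists2 B, D B & (NM_dist A B < e%:E)%E.

End newton_morrey.

Definition C1_function (R : realType) (n : nat) : set ('rV[R]_n -> R) :=
  [set f | continuous f /\
    forall i : 'I_n,
      (forall x, derivable f x (delta_mx 0 i)) /\
      continuous (fun x => 'D_(delta_mx 0 i) f x)].

Definition Lipschitz_function (R : realType) (n : nat) : set ('rV[R]_n -> R) :=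
  [set f | exists L : R, forall x y, `|f x - f y| <= L * edist x y].

(* Main.v *)
Require Import Defs.
From mathcomp Require Import all_boot all_order all_algebra.
From mathcomp Require Import all_classical all_reals all_analysis.
From mathcomp Require Import measurable_realfun ring lra.

Set Implicit Arguments.
Unset Strict Implicit.
Unset Printing Implicit Defensive.

Import Order.TTheory GRing.Theory Num.Theory.
Import numFieldNormedType.Exports.

Local Open Scope classical_set_scope.
Local Open Scope ring_scope.
(* so that edist is the Euclidean distance and not the extended distance of the
   same name *)
Import Defs.

(** Let the cubes of side s = 2^-k (with k a natural number) be disjoint and
    accumulate at 0, and let [comb] be the sum over k of the tents of slope
    H = V^(-1/q) supported in them, V = s^n being the volume. The function
    sum_k H 1_(cube k) is an upper gradient of [comb] ([comb_upper_gradient]), and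
    its Morrey norm is finite although it has the same order of magnitude on
    every cube ([integral_comb_gradient_pow]): for a ball of measure w,
    the integral of its p-th power is at most
    sum_k V^(-p/q) min(w, V), which is of order w^(1 - p/q) because p < q
    ([truncated_geometric_sum]). So [comb] belongs to the space ([comb_preNM]).

    A function g which is C^1 or Lipschitz has bounded slope in the first
    direction near 0, whereas the slope H of [comb] on the k-th cube tends to
    infinity. Thus on the segments parallel to the first axis that end near the
    centre of a small cube, the increment of comb - g is at least a constant times
    H s. If G is a weak upper gradient of comb - g, integrating over these
    segments and using Hoelder on a ball of radius comparable to s yields
    H s s^(n-1) <= const |G| V^(1-1/q), where |G| is the Morrey norm. Since
    H s s^(n-1) = V^(1-1/q), the norm |G| is bounded below independently of g, and
    g stays away from [comb] ([not_dense]).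

    The exceptional curves of a weak upper gradient are handled by adding to it a
    small multiple of a function admissible for them ([osc_bound_preNM]). This
    bounds the averaged increments over all the segments at once. Such bounds add
    up ([osc_boundD]), and so they pass through changes of representatives in the
    two classes whose distance is being estimated. *)

(** * Lebesgue measure of cubes, and integration of Borel functions *)

Section cubes.
Context (R : realType).
Let RT := measurableTypeR R.

(** The open ball of the max-norm, written coordinatewise so that it makes sense
    for n = 0 as well. *)
Definition cube (n : nat) (x : 'rV[R]_n) (r : R) : set 'rV[R]_n :=
  [set y | forall i, `|y 0 i - x 0 i| < r].

Lemma rV_of_tuple_coord n (t : n.-tuple RT) i : rV_of_tuple t 0 i = tnth t i.
Proof. by rewrite mxE. Qed.

Lemma continuous_rV_borel n (h : 'rV[R]_n -> R) : continuous h ->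
  measurable_fun setT (h : borel_rV R n -> R).
Proof.
move=> /continuousP ch.
apply: (measurability _ (RGenOpens.measurableE R)).
move=> _ [_ [a [b ->] <-]]; rewrite setTI.
by apply: sub_sigma_algebra; apply: ch; exact: interval_open.
Qed.

Lemma coord_continuous_rV n (i : 'I_n) : continuous (fun y : 'rV[R]_n => y 0 i).
Proof. exact: coord_continuous. Qed.

Lemma measurable_cube n (x : 'rV[R]_n) r :
  measurable (cube x r : set (borel_rV R n)).
Proof.
rewrite (_ : cube x r = \bigcap_(i in [set` enum 'I_n])
    ((fun y : 'rV[R]_n => y 0 i) @^-1` ball (x 0 i : R) r)).
  rewrite bigcap_seq; apply: bigsetI_measurable => i _.
  rewrite -[X in measurable X]setTI.
  apply: (continuous_rV_borel (@coord_continuous_rV n i)) => //.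
  by rewrite ball_itv; exact: measurable_itv.
apply/seteqP; split=> [t Bt i _|t Bt i].
  by have := Bt i; rewrite /ball/= /ball_ /= distrC.
by have := Bt i; rewrite /= mem_enum /ball/= /ball_/= distrC; apply.
Qed.

Lemma measurable_rV_of_tuple_preimage n (A : set 'rV[R]_n) :
  measurable (A : set (borel_rV R n)) ->
  measurable (@rV_of_tuple R n @^-1` A).
Proof.
by move=> mA; rewrite -[X in measurable X]setTI; exact: measurable_rV_of_tuple.
Qed.

Lemma tcons_cube n (x : 'rV[R]_n.+1) r :
  (@tcons R n) @^-1` ((@rV_of_tuple R n.+1) @^-1` cube x r) =
  ball (x 0 ord0) r `*`
  ((@rV_of_tuple R n) @^-1` cube (\row_i x 0 (lift ord0 i)) r).
Proof.
apply/seteqP; split=> [[a t] /= H|[a t] /= [Ha Ht] i].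
  split.
    by have := H ord0; rewrite rV_of_tuple_coord /= /ball/= /ball_/= distrC.
  move=> i; have := H (lift ord0 i); rewrite !rV_of_tuple_coord mxE.
  by rewrite /tcons/= tnthS.
have [j ->|->] := unliftP ord0 i.
  rewrite rV_of_tuple_coord /tcons/= tnthS.
  by have := Ht j; rewrite rV_of_tuple_coord mxE.
by rewrite rV_of_tuple_coord distrC.
Qed.

Lemma lebesgue_tuple_cube n (x : 'rV[R]_n) r : 0 <= r ->
  lebesgue_tuple R n (@rV_of_tuple R n @^-1` cube x r) = ((r *+ 2) ^+ n)%:E.
Proof.
move=> r0; elim: n x => [|n IH] x.
  rewrite expr0 /= /dirac indicE mem_set//.
  by move=> i; have := ltn_ord i.
rewrite /= /lebesgue_tcons /pushforward tcons_cube.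
rewrite product_measure1E//; last 2 first.
- by rewrite ball_itv; exact: measurable_itv.
- apply: measurable_rV_of_tuple_preimage; exact: measurable_cube.
by rewrite IH exprS EFinM; congr (_ * _)%E; exact: lebesgue_measure_ball.
Qed.

End cubes.

Section completion.
Context (R : realType) (n : nat).
Local Notation X := 'rV[R]_n.

Lemma borel_lebesgue_measurable (A : set X) :
  measurable (A : set (borel_rV R n)) -> measurable (A : set (lebesgue_rV R n)).
Proof. by move=> mA; apply: sub_caratheodory; exact: sub_sigma_algebra. Qed.

Lemma measurable_id_borel :
  measurable_fun setT (id : lebesgue_rV R n -> borel_rV R n).
Proof. by move=> _ A mA; rewrite setTI; exact: borel_lebesgue_measurable. Qed.

Lemma lebesgue_n_borelE (A : set X) : measurable (A : set (borel_rV R n)) ->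
  lebesgue_n R n A = lebesgue_tuple R n (@rV_of_tuple R n @^-1` A).
Proof.
by move=> mA; rewrite /= /completed_measure_extension measurable_mu_extE.
Qed.

(** On Borel data the completion is invisible: the completed measure pushes
    forward along the identity to the Borel measure, and the latter is by
    construction an image of the product measure on tuples. *)
Lemma integral_lebesgue_n (A : set X) (h : X -> \bar R) :
  measurable (A : set (borel_rV R n)) ->
  measurable_fun setT (h : borel_rV R n -> \bar R) -> (forall x, 0 <= h x)%E ->
  (\int[@lebesgue_n R n]_(x in A) h x =
   \int[lebesgue_tuple R n]_(t in @rV_of_tuple R n @^-1` A) h (rV_of_tuple t))%E.
Proof.
move=> mA mh h0.
have mhA : measurable_fun (A : set (borel_rV R n)) h.
  exact: measurable_funS mh.
have E1 := @ge0_integral_pushforward _ _ (lebesgue_rV R n) (borel_rV R n) R id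
  measurable_id_borel (@lebesgue_n R n) A h mA mhA (fun y _ => h0 y).
have E2 := @ge0_integral_pushforward _ _ _ (borel_rV R n) R (@rV_of_tuple R n)
  (@measurable_rV_of_tuple R n) (lebesgue_tuple R n) A h mA mhA (fun y _ => h0 y).
transitivity (\int[pushforward (@lebesgue_n R n)
  (id : lebesgue_rV R n -> borel_rV R n)]_(y in A) h y)%E; first exact/esym/E1.
transitivity (\int[@borel_lebesgue R n]_(y in A) h y)%E; last exact: E2.
pose idB : lebesgue_rV R n -> borel_rV R n := id.
pose m1 : {measure set (borel_rV R n) -> \bar R} :=
  pushforward (@lebesgue_n R n) idB.
pose m2 : {measure set (borel_rV R n) -> \bar R} := @borel_lebesgue R n.
have e12 : (\int[m1 measurable_id_borel]_(x in A) h x = \int[m2]_(x in A) h x)%E.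
  by apply: eq_measure_integral => B mB _; exact: lebesgue_n_borelE.
exact: e12.
Qed.

Lemma lebesgue_n_cube (x : X) r : 0 <= r ->
  lebesgue_n R n (cube x r) = ((r *+ 2) ^+ n)%:E.
Proof.
by move=> r0; rewrite lebesgue_n_borelE ?lebesgue_tuple_cube//; exact: measurable_cube.
Qed.

End completion.

(** * Euclidean balls and arc-length parameterized curves *)

Section euclid.
Context (R : realType) (n : nat).
Local Notation X := 'rV[R]_n.
Implicit Types (x y : X).

Lemma edist_ge0 x y : 0 <= edist x y.
Proof. exact: sqrtr_ge0. Qed.

Lemma edist_coord x y i : `|x 0 i - y 0 i| <= edist x y.
Proof.
rewrite /edist -sqrtr_sqr ler_sqrt ?sumr_ge0// => [|j _]; last exact: sqr_ge0.
by rewrite (bigD1 i)//= lerDl sumr_ge0// => j _; exact: sqr_ge0.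
Qed.

Lemma edist_le x y (M : R) : (forall i, `|x 0 i - y 0 i| <= M) -> 0 <= M ->
  edist x y <= n%:R * M.
Proof.
move=> xyM M0; have nM0 : 0 <= n%:R * M by rewrite mulr_ge0.
rewrite /edist -(ger0_norm nM0) -sqrtr_sqr ler_wsqrtr//.
apply: (@le_trans _ _ (\sum_(i < n) M ^+ 2)).
  apply: ler_sum => i _; rewrite -real_normK ?num_real//.
  by rewrite ler_sqr ?nnegrE.
rewrite sumr_const card_ord -[leLHS]mulr_natl exprMn; apply: ler_wpM2r.
  exact: sqr_ge0.
by rewrite -natrX ler_nat; case: (n) => // k; rewrite leq_pmulr.
Qed.

Lemma continuous_edist x : continuous (edist x).
Proof.
have cs : continuous (fun y : X => \sum_i (x 0 i - y 0 i) ^+ 2).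
  apply: (@continuous_big R 'I_n +%R 0 xpredT _ X (index_enum 'I_n)
    (fun i z => (x 0 i - z 0 i) ^+ 2)); first exact: add_continuous.
  move=> i _ y; apply: (@continuous_comp _ _ _ (fun z : X => x 0 i - z 0 i)
    (fun u : R => u ^+ 2)); last exact: exprn_continuous.
  apply: continuousB; first exact: cst_continuous.
  exact: coord_continuous_rV.
by move=> y; apply: continuous_comp; [exact: cs|exact: sqrt_continuous].
Qed.

Lemma measurable_eball x r : measurable (eball x r : set (borel_rV R n)).
Proof.
rewrite (_ : eball x r = edist x @^-1` `]-oo, r[%classic); last first.
  by apply/seteqP; split=> y; rewrite /eball/= in_itv.
rewrite -[X in measurable X]setTI.
by apply: continuous_rV_borel => //; exact: continuous_edist.
Qed.

Lemma eball_sub_cube x r : eball x r `<=` cube x r.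
Proof. by move=> y xyr i; rewrite distrC; apply: le_lt_trans xyr; exact: edist_coord. Qed.

Lemma cube_sub_eball x r : 0 < r -> cube x (r / n.+1%:R) `<=` eball x r.
Proof.
move=> r0 y xyr; apply: (@le_lt_trans _ _ (n%:R * (r / n.+1%:R))).
  by apply: edist_le => [i|]; [rewrite distrC; exact/ltW|rewrite divr_ge0// ltW].
by rewrite mulrCA gtr_pMr// ltr_pdivrMr// mul1r ltr_nat.
Qed.

(** By comparison with an inscribed and with the circumscribed cube. *)
Lemma lebesgue_n_eball x r : 0 < r -> exists w : R,
  [/\ 0 < w, w <= (r *+ 2) ^+ n & lebesgue_n R n (eball x r) = w%:E].
Proof.
move=> r0; have mB := measurable_eball x r.
have le1 : (lebesgue_n R n (eball x r) <= ((r *+ 2) ^+ n)%:E)%E.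
  rewrite -(lebesgue_n_cube x (ltW r0)); apply: le_measure; rewrite ?inE.
  - exact: borel_lebesgue_measurable.
  - apply: borel_lebesgue_measurable; exact: measurable_cube.
  - exact: eball_sub_cube.
have rn0 : 0 < r / n.+1%:R by rewrite divr_gt0.
have ge1 : ((((r / n.+1%:R) *+ 2) ^+ n)%:E <= lebesgue_n R n (eball x r))%E.
  rewrite -(lebesgue_n_cube x (ltW rn0)); apply: le_measure; rewrite ?inE.
  - apply: borel_lebesgue_measurable; exact: measurable_cube.
  - exact: borel_lebesgue_measurable.
  - exact: cube_sub_eball.
move: le1 ge1; case: (lebesgue_n R n (eball x r)) => [w||]//.
rewrite !lee_fin => le1 ge1; exists w; split=> //; apply: lt_le_trans ge1.
by rewrite exprn_gt0// pmulrn_lgt0.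
Qed.

End euclid.

Lemma norm_le_edist (R : realType) (n : nat) (x y : 'rV[R]_n.+1) :
  `|x - y| <= edist x y.
Proof.
rewrite [leLHS]mx_normrE; apply: bigmax_le => [|[i j] _]; first exact: edist_ge0.
by rewrite /= ord1 !mxE; exact: edist_coord.
Qed.

Section curves.
Context (R : realType) (n : nat).
Local Notation X := 'rV[R]_n.

(** If t is appended to a partition of [0, s], the inscribed length grows by the
    chord from c s to c t and remains at most t, whereas the inscribed lengths
    over [0, s] come arbitrarily close to s. *)
Lemma rcurve_lipschitz (c : rcurve R n) (s t : R) :
  s \in `[0, rcurve_len c] -> t \in `[0, rcurve_len c] ->
  edist (c s) (c t) <= `|s - t|.
Proof.
wlog st : s t / s <= t.
  move=> H cs ct; have [/H|/ltW /H] := leP s t; first exact.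
  rewrite distrC (_ : edist (c s) _ = edist (c t) (c s)); first exact.
  by rewrite /edist; congr (Num.sqrt _); apply: eq_bigr => i _; rewrite -sqrrN opprB.
move=> cs ct; move: st; rewrite le_eqVlt => /predU1P[->|st].
  rewrite subrr normr0 /edist big1 ?sqrtr0// => i _.
  by rewrite subrr expr0n.
rewrite distrC ger0_norm ?subr_ge0 ?(ltW st)// lerBrDl -lee_fin EFinD.
rewrite -leeBrDr// -[s%:E](rcurve_arc_length cs) -[t%:E](rcurve_arc_length ct).
apply: ge_ereal_sup => _ [p [pp /eqP lp] <-].
rewrite leeBrDr// -EFinD; apply: ereal_sup_ubound.
exists (rcons p t).
  split; last by rewrite last_rcons.
  by rewrite rcons_path pp lp.
have ps m (b : R) : (m < (size p).+1)%N ->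
  nth b (0 :: rcons p t) m = nth s (0 :: p) m.
  case: m => [//|m] /=; rewrite ltnS => mp.
  by rewrite nth_rcons mp; apply: set_nth_default.
rewrite /inscribed_length size_rcons big_nat_recr//; congr (_ + _)%:E.
  rewrite [LHS]big_nat_cond [RHS]big_nat_cond; apply: eq_bigr => k.
  rewrite andbT => /andP[_ kp]; rewrite /comp !(ps _ t)//.
  exact: ltnW.
rewrite /comp (ps (size p) t)// -[nth s _ _]last_nth lp.
by rewrite -cats1 -cat_cons nth_cat/= ltnn subnn.
Qed.

End curves.

(** * Segments parallel to the first axis *)

Section segments.
Context (R : realType) (n : nat).
Let RT := measurableTypeR R.
Local Notation X := 'rV[R]_n.+1.
Local Notation e1 := (delta_mx 0 ord0 : X).

(** The line parallel to the first axis through (0, y). In the coordinates (t, y)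
    the Lebesgue measure is literally the product measure, which is why segments
    of these lines, starting on the hyperplane t = 0, are the test curves. *)
Definition hline (y : n.-tuple RT) (t : R) : X := rV_of_tuple (tcons (t, y)).

Lemma hline0 y t : hline y t 0 ord0 = t.
Proof. by rewrite /hline rV_of_tuple_coord. Qed.

Lemma hlineS y t i : hline y t 0 (lift ord0 i) = tnth y i.
Proof. by rewrite /hline rV_of_tuple_coord /tcons/= tnthS. Qed.

Lemma hlineD y s t : hline y (s + t) = t *: e1 + hline y s.
Proof.
apply/rowP => i; have [j ->|->] := unliftP ord0 i.
  by rewrite !mxE/= !tnthS mulr0 add0r.
by rewrite !mxE/= mulr1 addrC.
Qed.

Lemma edist_hline y s t : edist (hline y s) (hline y t) = `|s - t|.
Proof.
rewrite /edist big_ord_recl !hline0 big1 ?addr0 ?sqrtr_sqr// => i _.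
by rewrite !hlineS subrr expr0n.
Qed.

Lemma continuous_hline y : continuous (hline y).
Proof.
rewrite (_ : hline y = fun t => t *: e1 + hline y 0); last first.
  by apply/funext => t; rewrite -hlineD add0r.
move=> t; apply: cvgD; last exact: cvg_cst.
by apply: cvgZr_tmp; exact: cvg_id.
Qed.

Lemma inscribed_length_hline y (a b : R) s : itv_partition a b s ->
  inscribed_length (hline y) a b s = b - a.
Proof.
elim: s a => [a /itv_partition_nil->|x s IH a H].
  by rewrite /inscribed_length big_geq// subrr.
have [ax _] := H; move: ax => /=/andP[ax _].
rewrite /inscribed_length/= big_nat_recl//= edist_hline.
have := IH x (itv_partition_cons H); rewrite /inscribed_length/= => ->.
by rewrite distrC gtr0_norm ?subr_gt0// addrC subrKA.
Qed.

Lemma curve_length_hline y (t : R) : 0 <= t ->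
  curve_length (hline y) 0 t = t%:E.
Proof.
move=> t0; rewrite /curve_length.
rewrite (_ : [set _ | _ in _] = [set t%:E]); first by rewrite ereal_sup1.
apply/seteqP; split=> [_ [s st <-]|_ ->].
  by rewrite /= inscribed_length_hline// subr0.
move: t0; rewrite le_eqVlt => /predU1P[<-|t0].
  by exists [::]; [split|rewrite inscribed_length_hline ?subr0//; split].
exists [:: t]; first exact: itv_partition1.
by rewrite inscribed_length_hline ?subr0//; exact: itv_partition1.
Qed.

Definition hsegment (y : n.-tuple RT) (l : R) (l0 : 0 <= l) : rcurve R n.+1.
Proof.
apply: (@RCurve R n.+1 l (hline y) l0).
  by apply: continuous_subspaceT; exact: continuous_hline.
by move=> t; rewrite in_itv/= => /andP[t0 _]; exact: curve_length_hline.
Defined.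

Lemma nonconstant_hsegment y (l : R) (l0 : 0 < l) :
  nonconstant (hsegment y (ltW l0)).
Proof.
exists 0, l; split; [by rewrite in_itv/= lexx ltW|by rewrite in_itv/= lexx ltW|].
move=> /= h; have : edist (hline y 0) (hline y l) = 0.
  by rewrite h edist_hline subrr normr0.
by rewrite edist_hline sub0r normrN gtr0_norm// => l00; rewrite l00 ltxx in l0.
Qed.

End segments.

(** * Weak upper gradients control average increments along segments *)

Section morrey_holder.
Context (R : realType) (n : nat) (p q : R).
Hypotheses (p1 : 1 < p) (pq : p < q).
Local Notation X := 'rV[R]_n.
Implicit Types (g rho : X -> \bar R).

Let p0 : 0 < p. Proof. exact: lt_trans p1. Qed.

Lemma morrey_norm_ge0 g : (0 <= morrey_norm p q g)%E.
Proof.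
apply: (@le_trans _ _ (poweR (@lebesgue_n R n (eball 0 1)) (q^-1 - p^-1) *
  poweR (\int[@lebesgue_n R n]_(y in eball 0%R 1) poweR `|g y| p) p^-1)%E).
  by rewrite mule_ge0// poweR_ge0.
apply: ereal_sup_ubound; exists 0%R; first by []. by exists 1%R; first exact: ltr01.
Qed.

(** If x > M, then x = x^(1-p) x^p with x^(1-p) <= M^(1-p). Optimizing M turns
    this pointwise bound into the inequality of Hoelder. *)
Lemma young_truncation (x : \bar R) (M : R) : 0 < M -> (0 <= x)%E ->
  (x <= M%:E + (M `^ (1 - p))%:E * poweR x p)%E.
Proof.
move=> M0; case: x => [x||]//; last first.
  by rewrite poweRyr ?gt_eqF// gt0_muley ?addey// lte_fin powR_gt0.
rewrite lee_fin => x0; rewrite poweR_EFin -EFinM -EFinD lee_fin.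
have [xM|Mx] := leP x M.
  by rewrite (le_trans xM)// lerDl mulr_ge0// powR_ge0.
apply: (@le_trans _ _ (M `^ (1 - p) * x `^ p)); last by rewrite lerDr ltW.
have x00 : 0 < x := lt_trans M0 Mx.
rewrite -[leLHS](@powRr1 _ x)// -[X in x `^ X](subrK p 1).
rewrite powRD ?(gt_eqF x00) ?implybT//; apply: ler_wpM2r; first exact: powR_ge0.
rewrite -(opprB p 1) !powRN lef_pV2 ?posrE ?powR_gt0//.
by apply: ge0_ler_powR; rewrite ?nnegrE ?subr_ge0 ltW.
Qed.

Lemma young_integral d (T : measurableType d) (mu : {measure set T -> \bar R})
    (B : set T) (g : T -> \bar R) (w M : R) :
  measurable B -> measurable_fun B g -> (forall y, 0 <= g y)%E ->
  mu B = w%:E -> 0 < M ->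
  (\int[mu]_(y in B) g y <=
   (M * w)%:E + (M `^ (1 - p))%:E * \int[mu]_(y in B) poweR `|g y| p)%E.
Proof.
move=> mB mg g0 wE M0.
have mgp : measurable_fun B (fun y => poweR `|g y| p).
  apply: (measurableT_comp (measurable_poweR p)).
  exact: measurableT_comp.
rewrite EFinM -wE -integral_cst// -ge0_integralZl//; last 2 first.
- by move=> y _; exact: poweR_ge0.
- by rewrite lee_fin powR_ge0.
rewrite -ge0_integralD//; last 3 first.
- by move=> y _; rewrite lee_fin ltW.
- by move=> y _; rewrite mule_ge0 ?lee_fin ?powR_ge0// poweR_ge0.
- exact: measurable_funeM.
apply: ge0_le_integral => //.
- by apply: emeasurable_funD => //; exact: measurable_funeM.
- by move=> y _; rewrite gee0_abs//; exact: young_truncation.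
Qed.

Lemma ge0_integralDZ d (T : measurableType d) (mu : {measure set T -> \bar R})
    (B : set T) (g h : T -> \bar R) (k : R) :
  measurable B -> measurable_fun B g -> measurable_fun B h ->
  (forall y, 0 <= g y)%E -> (forall y, 0 <= h y)%E -> 0 <= k ->
  (\int[mu]_(y in B) (g y + k%:E * h y) =
   \int[mu]_(y in B) g y + k%:E * \int[mu]_(y in B) h y)%E.
Proof.
move=> mB mg mh g0 h0 k0; rewrite ge0_integralD//; last 2 first.
- by move=> y _; rewrite mule_ge0.
- exact: measurable_funeM.
by rewrite ge0_integralZl.
Qed.

Lemma borel_nonneg_lebesgue g (A : set X) : borel_nonneg g ->
  measurable_fun (A : set (lebesgue_rV R n)) g.
Proof.
move=> [mg _]; apply: measurable_funTS => /= _ B mB.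
rewrite setTI; apply: borel_lebesgue_measurable.
by rewrite -[X in measurable X]setTI; exact: mg.
Qed.

Lemma morrey_norm_integral_pow g (x : X) (r w e : R) : 0 < r -> 0 < e -> 0 < w ->
  lebesgue_n R n (eball x r) = w%:E -> (morrey_norm p q g < e%:E)%E ->
  (\int[@lebesgue_n R n]_(y in eball x r) poweR `|g y| p
     <= ((e * w `^ (p^-1 - q^-1)) `^ p)%:E)%E.
Proof.
move=> r0 e0 w0 wE ge; set I := integral _ _ _.
have I0 : (0 <= I)%E by apply: integral_ge0 => y _; exact: poweR_ge0.
have H : (poweR w%:E (q^-1 - p^-1) * poweR I p^-1 <= e%:E)%E.
  apply: le_trans (ltW ge); apply: ereal_sup_ubound.
  by exists x => //; exists r => //; rewrite wE.
rewrite -[leLHS]poweRe1// -(mulVf (lt0r_neq0 p0)) poweRrM -poweR_EFin.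
apply: gt0_ler_poweR; rewrite ?in_itv/= ?leey ?andbT.
- exact: ltW.
- exact: poweR_ge0.
- by rewrite lee_fin mulr_ge0 ?powR_ge0 ?ltW.
move: H; rewrite poweR_EFin -(opprB p^-1) powRN muleC.
by rewrite lee_pdivrMr ?powR_gt0// EFinM.
Qed.

(** Hoelder's inequality on a ball: the weight in the Morrey norm cancels the power
    of w that depends on p. *)
Lemma morrey_norm_integral g (x : X) (r w e : R) : 0 < r -> 0 < e -> 0 < w ->
  borel_nonneg g ->
  lebesgue_n R n (eball x r) = w%:E -> (morrey_norm p q g < e%:E)%E ->
  (\int[@lebesgue_n R n]_(y in eball x r) g y
     <= (2 * e * w `^ (1 - q^-1))%:E)%E.
Proof.
move=> r0 e0 w0 bg wE ge.
have q0 : 0 < q := lt_trans p0 pq.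
have Ile := morrey_norm_integral_pow r0 e0 w0 wE ge.
(* this truncation level makes the two terms of the bound equal *)
pose M := e * w `^ (- q^-1).
have M0 : 0 < M by rewrite mulr_gt0// powR_gt0.
have mB : measurable (eball x r : set (lebesgue_rV R n)).
  by apply: borel_lebesgue_measurable; exact: measurable_eball.
have mg : measurable_fun (eball x r : set (lebesgue_rV R n)) g.
  exact: borel_nonneg_lebesgue.
apply: (le_trans (young_integral mB mg bg.2 wE M0)).
move: Ile; move: (integral _ _ _) => I Ile.
apply: (@le_trans _ _ ((M * w)%:E + (M `^ (1 - p))%:E *
   ((e * w `^ (p^-1 - q^-1)) `^ p)%:E)%E).
  apply: leeD; first exact: lexx.
  by apply: lee_wpmul2l; [rewrite lee_fin powR_ge0|exact: Ile].
rewrite -EFinM -EFinD lee_fin.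
have -> : M * w = e * w `^ (1 - q^-1).
  rewrite /M -mulrA; congr (_ * _).
  by rewrite [1 - _]addrC powRD ?(gt_eqF w0) ?implybT// powRr1// ltW.
have -> : M `^ (1 - p) * (e * w `^ (p^-1 - q^-1)) `^ p = e * w `^ (1 - q^-1).
  rewrite /M !powRM ?powR_ge0 ?(ltW e0)// -!powRrM mulrACA; congr (_ * _).
    by rewrite -powRD ?(gt_eqF e0) ?implybT// subrK powRr1// ltW.
  rewrite -powRD ?(gt_eqF w0) ?implybT//; congr (_ `^ _).
  by field; rewrite !gt_eqF.
lra.
Qed.

End morrey_holder.

Lemma tonelli_rectangle_ge d1 d2 (T1 : measurableType d1)
    (T2 : measurableType d2) (R : realType)
    (m1 : {sigma_finite_measure set T1 -> \bar R})
    (m2 : {sigma_finite_measure set T2 -> \bar R})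
    (A : set T1) (Q : set T2) (S : set (T1 * T2)) (F : T1 * T2 -> \bar R) (m : R) :
  measurable A -> measurable Q -> measurable S -> A `*` Q `<=` S -> 0 <= m ->
  measurable_fun setT F -> (forall z, 0 <= F z)%E ->
  (forall y, Q y -> m%:E <= \int[m1]_(x in A) F (x, y))%E ->
  (m%:E * m2 Q <= \int[(m1 \x m2)%E]_(z in S) F z)%E.
Proof.
move=> mA mQ mS AQS m0 mF F0 FQ.
have mAQ : measurable (A `*` Q) by exact: measurableX.
apply: (@le_trans _ _ (\int[(m1 \x m2)%E]_(z in A `*` Q) F z)%E); last first.
  by apply: ge0_subset_integral => //; exact: measurable_funTS.
have F10 z : (0 <= (F \_ (A `*` Q)) z)%E by exact: erestrict_ge0.
have mF1 : measurable_fun setT (F \_ (A `*` Q)).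
  by apply/(measurable_restrictT _ _).1 => //; exact: measurable_funTS.
rewrite integral_mkcond fubini_tonelli2// -integral_cst//.
have mG := @measurable_fun_fubini_tonelli_G _ _ _ _ _ m1 _ mF1 F10.
have G0 y : (0 <= fubini_G m1 (F \_ (A `*` Q)) y)%E by exact: integral_ge0.
apply: (@le_trans _ _ (\int[m2]_(y in Q) fubini_G m1 (F \_ (A `*` Q)) y)%E).
  apply: ge0_le_integral => //.
  - exact: measurable_funTS.
  - move=> y Qy; apply: (le_trans (FQ y Qy)).
    rewrite /fubini_G [leLHS]integral_mkcond le_eqVlt; apply/orP; left; apply/eqP.
    apply: eq_integral => x _; rewrite /patch in_setX/= (mem_set Qy) andbT.
    by [].
by apply: ge0_subset_integral => //.
Qed.

Section oscillation.
Context (R : realType) (n : nat) (p q : R).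
Hypotheses (p1 : 1 < p) (pq : p < q).
Let RT := measurableTypeR R.
Local Notation X := 'rV[R]_n.+1.
Implicit Types (u : X -> R).

(** A certificate that the increments of u along the segments of length l are
    small on average. The increments are truncated at m so that a single function
    G can also serve on the exceptional curves of a weak upper gradient, where
    the increment is not controlled. *)
Definition osc_bound (B : set X) (l m : R) u (d : R) : Prop :=
  exists G : X -> \bar R, [/\ borel_nonneg G,
    (\int[@lebesgue_n R n.+1]_(x in B) G x <= d%:E)%E &
    forall y : n.-tuple RT,
      ((Num.min m `|u (hline y 0) - u (hline y l)|)%:E <=
       \int[lebesgue_measure]_(t in `[0%R, l]) G (hline y t))%E].

Lemma measurable_hline_comp (G : X -> \bar R) y : borel_nonneg G ->
  measurable_fun setT (fun t : RT => G (hline y t)).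
Proof.
move=> [mG _]; apply: (measurableT_comp mG).
apply: (measurableT_comp (@measurable_rV_of_tuple R n.+1)).
apply: (measurableT_comp (@measurable_tcons R n)).
exact: measurable_pair2.
Qed.

Lemma borel_nonnegD (G1 G2 : X -> \bar R) : borel_nonneg G1 -> borel_nonneg G2 ->
  borel_nonneg (fun x => G1 x + G2 x)%E.
Proof.
move=> [m1 h1] [m2 h2]; split; first exact: emeasurable_funD.
by move=> x; rewrite adde_ge0.
Qed.

Lemma borel_nonnegZ (G1 : X -> \bar R) (k : R) : 0 <= k -> borel_nonneg G1 ->
  borel_nonneg (fun x => k%:E * G1 x)%E.
Proof.
move=> k0 [m1 h1]; split; first exact: measurable_funeM.
by move=> x; rewrite mule_ge0.
Qed.

Lemma osc_boundD B l m u1 u2 d1 d2 : measurable (B : set (borel_rV R n.+1)) ->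
  0 <= m ->
  osc_bound B l m u1 d1 -> osc_bound B l m u2 d2 ->
  osc_bound B l m (fun x => u1 x + u2 x) (d1 + d2).
Proof.
move=> mB m0 [G1 [b1 I1 H1]] [G2 [b2 I2 H2]].
have mB' := borel_lebesgue_measurable mB.
exists (fun x => G1 x + G2 x)%E; split; first exact: borel_nonnegD.
  have := ge0_integralDZ (@lebesgue_n R n.+1) mB' (borel_nonneg_lebesgue b1)
    (borel_nonneg_lebesgue b2) b1.2 b2.2 ler01.
  under eq_integral do rewrite mul1e.
  by move=> ->; rewrite mul1e EFinD leeD.
move=> y; rewrite ge0_integralD//; last 4 first.
- by move=> x _; exact: b1.2.
- by apply: measurable_funTS; exact: measurable_hline_comp.
- by move=> x _; exact: b2.2.
- by apply: measurable_funTS; exact: measurable_hline_comp.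
apply: le_trans (leeD (H1 y) (H2 y)); rewrite -EFinD lee_fin.
set a := u1 (hline y 0) - u1 (hline y l); set b := u2 (hline y 0) - u2 (hline y l).
rewrite (_ : _ - _ = a + b); last by rewrite /a /b opprD addrACA.
have := ler_normD a b; have := normr_ge0 a; have := normr_ge0 b.
move: `|a| `|b| `|a + b| => A C D C0 A0 DAC.
clear -m0 C0 A0 DAC.
case: (leP m A); case: (leP m C); case: (leP m D); lra.
Qed.

Lemma osc_boundN B l m u d : osc_bound B l m u d ->
  osc_bound B l m (fun x => - u x) d.
Proof.
move=> [G [b I H]]; exists G; split=> // y.
by rewrite -opprD normrN; exact: H.
Qed.

(** Take G = g + m rho, where g is a weak upper gradient of u and rho is
    admissible for its exceptional family, of Morrey norm below e / m: on a
    segment of the family, m rho alone has integral at least m. The resulting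
    bound thus holds on every segment. *)
Lemma osc_bound_preNM u (x : X) (r w e l m : R) : 0 < r -> 0 < e -> 0 < w ->
  0 < l -> 0 < m -> lebesgue_n R n.+1 (eball x r) = w%:E ->
  (preNM_norm p q u < e%:E)%E ->
  osc_bound (eball x r) l m u (4 * e * w `^ (1 - q^-1)).
Proof.
move=> r0 e0 w0 l0 m0 wE ue.
have : (ereal_inf [set morrey_norm p q g | g in weak_upper_gradient p q u]
        < e%:E)%E.
  apply: le_lt_trans ue; by rewrite /preNM_norm leeDr// morrey_norm_ge0.
move=> /ereal_inf_lt[_ [g [bg [Gam mod0 ugG]] <-] ge].
have : (ereal_inf [set poweR (morrey_norm p q rho) p | rho in admissible Gam]
   < ((e / m) `^ p)%:E)%E.
  by rewrite -/(morrey_modulus p q Gam) mod0 lte_fin powR_gt0// divr_gt0.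
move=> /ereal_inf_lt[_ [rho [brho arho] <-] rhoe].
have {}rhoe : (morrey_norm p q rho < (e / m)%:E)%E.
  rewrite ltNge; apply/negP => le_rho; move: rhoe; apply/negP; rewrite -leNgt.
  rewrite -poweR_EFin; apply: gt0_ler_poweR; rewrite ?in_itv/= ?leey ?andbT//.
  - by rewrite ltW// (lt_trans _ p1).
  - by rewrite lee_fin divr_ge0 ?ltW.
  - by apply: le_trans le_rho; rewrite lee_fin divr_ge0 ?ltW.
have brho' := borel_nonnegZ (ltW m0) brho.
have mB := borel_lebesgue_measurable (measurable_eball x r).
exists (fun z => g z + m%:E * rho z)%E; split.
- exact: borel_nonnegD.
- rewrite (ge0_integralDZ _ mB (borel_nonneg_lebesgue bg)
    (borel_nonneg_lebesgue brho) bg.2 brho.2 (ltW m0)).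
  have I1 := morrey_norm_integral p1 pq r0 e0 w0 bg wE ge.
  have I2 := morrey_norm_integral p1 pq r0 (divr_gt0 e0 m0) w0 brho wE rhoe.
  apply: (@le_trans _ _ ((2 * e * w `^ (1 - q^-1))%:E +
     m%:E * (2 * (e / m) * w `^ (1 - q^-1))%:E)%E).
    by apply: leeD; [exact: I1|apply: lee_wpmul2l; [rewrite lee_fin ltW|exact: I2]].
  rewrite -EFinM -EFinD lee_fin le_eqVlt; apply/orP; left; apply/eqP.
  by field; rewrite gt_eqF.
- move=> y; pose c := hsegment y (ltW l0).
  have mg : measurable_fun `[0, l] (fun t : RT => g (hline y t)).
    by apply: measurable_funTS; exact: measurable_hline_comp.
  have mr : measurable_fun `[0, l] (fun t : RT => rho (hline y t)).
    by apply: measurable_funTS; exact: measurable_hline_comp.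
  rewrite [leRHS](_ : _ =
    (\int[lebesgue_measure]_(t in `[0%R, l]) g (hline y t) + m%:E *
     \int[lebesgue_measure]_(t in `[0%R, l]) rho (hline y t))%E); last first.
    have E := ge0_integralDZ (@lebesgue_measure R) (measurable_itv `[0, l])
      mg mr (fun t => bg.2 _) (fun t => brho.2 _) (ltW m0).
    exact: E.
  have [cG|ncG] := pselect (Gam c).
    have := arho c cG; rewrite /line_integral/= => arc.
    apply: (@le_trans _ _ (m%:E * 1)%E).
      by rewrite mule1 lee_fin ge_min lexx.
    apply: (@le_trans _ _ (m%:E *
      \int[lebesgue_measure]_(t in `[0%R, l]) rho (hline y t))%E).
      by rewrite lee_wpmul2l// lee_fin ltW.
    by rewrite leeDr// integral_ge0// => z _; exact: bg.2.
  have := ugG c (nonconstant_hsegment y l0) ncG.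
  rewrite /line_integral/= => ugc; apply: (le_trans _ (le_trans ugc _)).
    by rewrite lee_fin ge_min lexx orbT.
  rewrite leeDl// mule_ge0 ?lee_fin ?(ltW m0)// integral_ge0// => z _.
  exact: brho.2.
Qed.

(** Fubini: integrating over y in Q the lower bound m for the line integrals of G
    gives at most the integral of G over B, which contains all these segments. *)
Lemma osc_bound_le (B : set X) l m u d (Q : set (n.-tuple RT)) (v : R) :
  measurable (B : set (borel_rV R n.+1)) -> measurable Q -> 0 <= m ->
  (forall y t, Q y -> t \in `[0, l] -> B (hline y t)) ->
  (forall y, Q y -> m <= `|u (hline y 0) - u (hline y l)|) ->
  lebesgue_tuple R n Q = v%:E ->
  osc_bound B l m u d -> m * v <= d.
Proof.
move=> mB mQ m0 QB Qu vE [G [bG Id Gu]].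
rewrite -lee_fin EFinM -vE; apply: le_trans Id.
have mGl : measurable_fun setT (fun z : RT * n.-tuple RT =>
    G (rV_of_tuple (tcons z))).
  apply: (measurableT_comp bG.1).
  apply: (measurableT_comp (@measurable_rV_of_tuple R n.+1)).
  exact: measurable_tcons.
rewrite integral_lebesgue_n//; [|exact: bG.1|exact: bG.2].
have mrB := measurable_rV_of_tuple_preimage mB.
have mS : measurable (@tcons R n @^-1` (@rV_of_tuple R n.+1 @^-1` B)).
  by rewrite -[X in measurable X]setTI; exact: measurable_tcons.
apply: (@le_trans _ _ (\int[(@lebesgue_measure R \x lebesgue_tuple R n)%E]_(z in
    @tcons R n @^-1` (@rV_of_tuple R n.+1 @^-1` B)) G (rV_of_tuple (tcons z)))%E).
  have QS : `[0, l]%classic `*` Q `<=`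
      @tcons R n @^-1` (@rV_of_tuple R n.+1 @^-1` B).
    by move=> -[t y] /= [tl Qy]; exact: QB.
  have GQ y : Q y ->
      (m%:E <= \int[lebesgue_measure]_(t in `[0%R, l]) G (hline y t))%E.
    move=> Qy; apply: le_trans (Gu y).
    by rewrite lee_fin le_min lexx/= Qu.
  have := tonelli_rectangle_ge (m1 := @lebesgue_measure R)
    (lebesgue_tuple R n) (measurable_itv `[0, l]) mQ mS QS m0 mGl
    (fun z => bG.2 _) GQ.
  exact.
rewrite le_eqVlt; apply/orP; left; apply/eqP/esym.
have mGr : measurable_fun (@rV_of_tuple R n.+1 @^-1` B)
    (fun t : n.+1.-tuple RT => G (rV_of_tuple t)).
  apply: measurable_funTS; apply: (measurableT_comp bG.1).
  exact: measurable_rV_of_tuple.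
exact: (ge0_integral_pushforward (@measurable_tcons R n)
  (@lebesgue_measure R \x lebesgue_tuple R n)%E mrB mGr (fun y _ => bG.2 _)).
Qed.

End oscillation.

(** * A truncated geometric sum *)

(** A measure-w part of cubes of volumes x^k, weighted by (x^k)^(-th): the terms
    with x^k <= w form a convergent geometric series, those with x^k > w a series
    that grows geometrically up to x^k ~ w, so both parts are of the order of the
    term at the scale w, namely w^(1-th). The proof avoids the splitting index and
    uses the self-similarity S (N+1) w = min w 1 + b S N (w/x) instead. *)
Section truncated_geometric_sum.
Context (R : realType) (x th : R).
Hypotheses (x0 : 0 < x) (x1 : x < 1) (th0 : 0 < th) (th1 : th < 1).

Let a := x `^ (- th).
Let b := x * a.
Let h (w : R) := w `^ (1 - th).
Let S N (w : R) := \sum_(k < N) a ^+ k * Num.min w (x ^+ k).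
Let D := (a - 1)^-1.
Let C := (1 - b)^-1 + 1 + D.

Let a0 : 0 < a. Proof. exact: powR_gt0. Qed.

Let one_powR (r : R) : 1 = 1 `^ r. Proof. by rewrite powR1. Qed.

Let a1 : 1 < a.
Proof.
rewrite /a powRN invf_gt1 ?powR_gt0// [ltRHS](one_powR th).
by apply: gt0_ltr_powR; rewrite ?nnegrE ?ltW.
Qed.

Let b0 : 0 < b. Proof. exact: mulr_gt0. Qed.

Let bE : b = h x.
Proof.
by rewrite /b /h powRD ?(gt_eqF x0) ?implybT// powRr1// ltW.
Qed.

Let h0 w : 0 < w -> 0 < h w. Proof. exact: powR_gt0. Qed.

Let b1 : b < 1.
Proof.
rewrite bE [ltRHS](one_powR (1 - th)).
by apply: gt0_ltr_powR; rewrite ?nnegrE ?subr_gt0 ?ltW.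
Qed.

Let hscale w : 0 < w -> b * h (w / x) = h w.
Proof.
move=> w0; rewrite bE -powRM ?ltW ?divr_gt0// mulrCA divff ?mulr1//.
exact: lt0r_neq0.
Qed.

Let hmono w v : 0 < w -> w <= v -> h w <= h v.
Proof.
move=> w0 wv; have v0 := lt_le_trans w0 wv.
by apply: ge0_ler_powR; rewrite ?nnegrE ?subr_ge0 ?(ltW th1) ?(ltW w0) ?(ltW v0).
Qed.

Let h_ge w : 0 < w -> w <= 1 -> w <= h w.
Proof.
move=> w0 w1; rewrite -[leLHS](powRr1 (ltW w0)).
rewrite -[X in w `^ X](subrK (1 - th)) powRD ?(gt_eqF w0) ?implybT//.
rewrite ger_pMl ?powR_gt0// [leRHS](one_powR (1 - (1 - th))).
apply: ge0_ler_powR => //; rewrite ?nnegrE ?ler01 ?(ltW w0)//.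
by rewrite subKr ltW.
Qed.

Let S_recl N w : S N.+1 w = Num.min w 1 + b * S N (w / x).
Proof.
rewrite /S big_ord_recl expr0 mul1r; congr (_ + _).
rewrite mulr_sumr; apply: eq_bigr => k _; rewrite !lift0.
have -> : Num.min w (x ^+ k.+1) = x * Num.min (w / x) (x ^+ k).
  by rewrite minr_pMr ?ltW// exprS mulrCA divff ?mulr1// lt0r_neq0.
by rewrite exprS /b; ring.
Qed.

Let S_geom N w : S N w <= (1 - b)^-1.
Proof.
apply: (@le_trans _ _ (\sum_(k < N) b ^+ k)).
  apply: ler_sum => k _; rewrite /b exprMn mulrC ler_wpM2r//.
    by rewrite exprn_ge0// ltW.
  by rewrite ge_min lexx orbT.
have bN : (1 - b) * \sum_(k < N) b ^+ k = 1 - b ^+ N.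
  by rewrite -[1 - b]opprB mulNr -subrX1 opprB.
rewrite -[leRHS]mul1r ler_pdivlMr ?subr_gt0// mulrC bN.
by rewrite lerBlDr lerDl exprn_ge0// ltW.
Qed.

(* This relation characterizes D; it makes the induction of S_le1 close. *)
Let D_id : D * a = 1 + D.
Proof. by rewrite /D; field; rewrite subr_eq0 gt_eqF. Qed.

Let D0 : 0 < D. Proof. by rewrite invr_gt0 subr_gt0. Qed.

Let C1 : 0 < (1 - b)^-1. Proof. by rewrite invr_gt0 subr_gt0. Qed.

(** The negative term - D w absorbs the summand min w 1 = w which each step of the
    recursion contributes; C h w alone is reproduced exactly and leaves no room. *)
Let S_le1 N w : 0 < w -> w <= 1 -> S N w <= C * h w - D * w.
Proof.
elim: N w => [|N IH] w w0 w1.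
  rewrite /S big_ord0 subr_ge0; have hw := h_ge w0 w1.
  by apply: ler_pM; rewrite ?(ltW D0) ?(ltW w0)// /C lerDr addr_ge0 ?ltW.
rewrite S_recl (min_l w1); have wx0 : 0 < w / x by rewrite divr_gt0.
have [wx1|wx1] := leP (w / x) 1.
  have := IH _ wx0 wx1; rewrite -(ler_pM2l b0) mulrBr.
  rewrite [b * (C * _)]mulrCA hscale//.
  have -> : b * (D * (w / x)) = (1 + D) * w.
    by rewrite -D_id /b; field; exact: lt0r_neq0.
  lra.
have xw : x <= w by move: wx1; rewrite ltr_pdivlMr// mul1r => /ltW.
have := S_geom N (w / x); rewrite -(ler_pM2l b0) => Sg.
have bh : b <= h w by rewrite bE; exact: hmono.
have wh := h_ge w0 w1.
have : b * (1 - b)^-1 <= h w * (1 - b)^-1 by rewrite ler_pM2r.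
have : D * w <= D * h w by rewrite ler_pM2l.
rewrite /C !mulrDl mul1r [(1 - b)^-1 * _]mulrC; lra.
Qed.

Lemma truncated_geometric_sum : exists2 K : R, 0 < K &
  forall N (w : R), 0 < w ->
    \sum_(k < N) a ^+ k * Num.min w (x ^+ k) <= K * w `^ (1 - th).
Proof.
have C0 : 0 < C by rewrite /C !addr_gt0.
exists C => // N w w0; have [w1|w1] := leP w 1.
  apply: (le_trans (S_le1 N w0 w1)).
  by rewrite lerBlDr lerDl mulr_ge0 ?ltW.
apply: (le_trans (S_geom N w)); apply: (@le_trans _ _ (C * 1)).
  by rewrite mulr1 /C -addrA lerDl addr_ge0 ?ltW.
rewrite ler_pM2l// [leLHS](one_powR (1 - th)).
by apply: ge0_ler_powR; rewrite ?nnegrE ?subr_ge0 ?ltW.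
Qed.

End truncated_geometric_sum.

(** * A sum of dyadic bumps and its upper gradient *)

Section lipschitz_support.
Context (R : realType).
Let RT := measurableTypeR R.
Local Notation mu1 := (@lebesgue_measure R).

(** An L-Lipschitz function cannot vanish before the time |phi 0| / L, nor later
    than |phi l| / L before l. If these two time intervals are disjoint, they
    contribute |phi 0| + |phi l| to the integral; otherwise phi has no zero and
    the Lipschitz bound on [0, l] suffices. *)
Lemma lipschitz_integral_support (phi : R -> R) (l L : R) (h : RT -> \bar R) :
  0 <= l -> 0 < L ->
  (forall s t, s \in `[0, l] -> t \in `[0, l] ->
     `|phi s - phi t| <= L * `|s - t|) ->
  measurable_fun `[0, l] h -> (forall t, 0 <= h t)%E ->
  (forall t, t \in `[0, l] -> phi t != 0 -> (L%:E <= h t)%E) ->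
  (`|phi 0 - phi l|%:E <= \int[mu1]_(t in `[0%R, l]) h t)%E.
Proof.
move=> l0 L0 lip mh h0 Lh.
have I0 : 0 \in `[0, l] by rewrite in_itv/= lexx.
have Il : l \in `[0, l] by rewrite in_itv/= lexx andbT.
pose a := `|phi 0| / L; pose b := `|phi l| / L.
have a0 : 0 <= a by rewrite divr_ge0// ltW.
have b0 : 0 <= b by rewrite divr_ge0// ltW.
have aL : `|phi 0| = a * L by rewrite /a divfK// gt_eqF.
have bL : `|phi l| = b * L by rewrite /b divfK// gt_eqF.
(* phi cannot reach 0 before the time |phi 0| / L *)
have nz0 t : t \in `[0, l] -> t < a -> phi t != 0.
  move=> tl ta; apply/eqP => pt; have := lip 0 t I0 tl.
  rewrite pt subr0 sub0r normrN (ger0_norm (x := t)); last first.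
    by move: tl; rewrite in_itv/= => /andP[].
  by rewrite aL mulrC ler_pM2l// leNgt ta.
have nzl t : t \in `[0, l] -> l - b < t -> phi t != 0.
  move=> tl tb; apply/eqP => pt; have := lip l t Il tl.
  rewrite pt subr0 (ger0_norm (x := l - t)); last first.
    by move: tl; rewrite in_itv/= subr_ge0 => /andP[].
  rewrite bL mulrC ler_pM2l// leNgt; move: tb; rewrite ltrBlDr -ltrBlDl => -> //.
have int_cst (i : interval R) (r : R) : [set` i] `<=` `[0, l]%classic ->
    (forall t, t \in i -> phi t != 0) -> mu1 [set` i] = r%:E ->
    ((L * r)%:E <= \int[mu1]_(t in [set` i]) h t)%E.
  move=> il iphi ir; have mi := measurable_itv i.
  rewrite EFinM -ir -integral_cst//; apply: ge0_le_integral => //.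
  - by move=> t _; rewrite lee_fin ltW.
  - exact: measurable_funS mh.
  - by move=> t ti; apply: Lh; [exact: il|exact: iphi].
have [ab|ab] := leP a (l - b); last first.
  apply: (@le_trans _ _ (L * l)%:E).
    rewrite lee_fin; apply: le_trans (lip _ _ I0 Il) _.
    by rewrite sub0r normrN (ger0_norm l0).
  apply: int_cst => // [t tl|].
    have [ta|at_] := ltP t a; first exact: nz0.
    by apply: nzl => //; exact: lt_le_trans at_.
  rewrite lebesgue_measure_itv/= lte_fin; case: ltgtP l0 => // [_ _|<- _//].
  by rewrite sube0.
have mA : measurable (`[0, a[%classic : set RT) by exact: measurable_itv.
have mB : measurable (`]l - b, l]%classic : set RT) by exact: measurable_itv.
have al : a <= l by rewrite (le_trans ab)// gerBl.
have sA : `[0, a[%classic `<=` `[0, l]%classic.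
  move=> t /=; rewrite !in_itv/= => /andP[-> ta]/=.
  by rewrite (le_trans (ltW ta)).
have sB : `]l - b, l]%classic `<=` `[0, l]%classic.
  move=> t /=; rewrite !in_itv/= => /andP[bt ->]; rewrite andbT.
  by rewrite (le_trans _ (ltW bt))// (le_trans a0).
apply: (@le_trans _ _ (\int[mu1]_(t in `[0%R, a[%classic `|` `](l - b)%R, l]%classic) h t)%E); last first.
  have mAB : measurable (`[0, a[%classic `|` `]l - b, l]%classic : set RT).
    exact: measurableU.
  by apply: (ge0_subset_integral _ mAB _ mh) => // t [/sA|/sB].
rewrite ge0_integral_setU//; last 2 first.
- apply: measurable_funS mh => // t [/sA|/sB] //.
- apply/disj_setPLR => t /= + /=; rewrite !in_itv/= => /andP[_ ta] /andP[bt _].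
  by have := lt_trans ta (le_lt_trans ab bt); rewrite ltxx.
apply: (@le_trans _ _ ((L * a)%:E + (L * b)%:E)%E).
  rewrite -EFinD lee_fin (le_trans (ler_normB _ _))// aL bL.
  by rewrite ![L * _]mulrC.
apply: leeD; apply: int_cst => //.
- by move=> t ta; apply: nz0; [exact: sA|move: ta; rewrite in_itv/= => /andP[]].
- rewrite lebesgue_measure_itv/= lte_fin; case: ltgtP a0 => // [_ _|<- _//].
  by rewrite sube0.
- by move=> t tb; apply: nzl; [exact: sB|move: tb; rewrite in_itv/= => /andP[]].
- rewrite lebesgue_measure_itv/= lte_fin ltrBlDr ltrDl.
  case: ltgtP b0 => // [_ _|<- _//].
  by rewrite -EFinB opprB addrC subrK.
Qed.

End lipschitz_support.

Lemma cube_norm (R : realType) (n : nat) (x y : 'rV[R]_n.+1) (r : R) :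
  cube x r y <-> `|y - x| < r.
Proof.
split=> [xyr|xyr i].
  rewrite [ltLHS]mx_normrE; apply/bigmax_ltP; split=> [|[i j] _].
    exact: le_lt_trans (xyr ord0).
  by rewrite /= ord1 !mxE; exact: xyr.
apply: le_lt_trans xyr; rewrite [leRHS]mx_normrE.
apply: le_trans (le_bigmax _
  (fun ij : 'I_1 * 'I_n.+1 => `|(y - x) ij.1 ij.2|) (0, i)).
by rewrite /= !mxE.
Qed.

Section dyadic_bumps.
Context (R : realType) (n : nat) (q : R).
Let RT := measurableTypeR R.
Local Notation X := 'rV[R]_n.+1.
Implicit Types (x y : X) (k : nat).

(** The k-th cube has side 2^-k and its first coordinates range over
    ]2^-k, 2^(1-k)[, so that the cubes are disjoint and accumulate at 0. The height
    is the volume to the power -1/q: this makes the gradient of each bump have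
    Morrey norm of order 1, whatever k is. *)
Definition side k : R := 2^-1 ^+ k.
Definition center k : X := (3 / 2 * side k) *: delta_mx 0 ord0.
Definition dyadic_cube k : set X := cube (center k) (side k / 2).
Definition height k : R := (side k ^+ n.+1) `^ (- q^-1).
Definition bump k x : R := height k * Num.max 0 (side k / 2 - `|x - center k|).

Lemma side_gt0 k : 0 < side k.
Proof. by rewrite exprn_gt0// invr_gt0. Qed.

Lemma side_le1 k : side k <= 1.
Proof. by rewrite exprn_ile1// ?invr_ge0// invf_le1// ler1n. Qed.

Lemma height_gt0 k : 0 < height k.
Proof. by rewrite powR_gt0// exprn_gt0// side_gt0. Qed.

Lemma bump_ge0 k x : 0 <= bump k x.
Proof. by rewrite mulr_ge0 ?(ltW (height_gt0 k))// le_max lexx. Qed.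

Lemma bump_lipschitz k x y : `|bump k x - bump k y| <= height k * `|x - y|.
Proof.
rewrite -mulrBr normrM (gtr0_norm (height_gt0 k)) ler_pM2l ?height_gt0//.
have := ler_distD y x (center k); have := ler_distD x y (center k).
rewrite (distrC y x) => A B.
have h (a b d : R) : a <= b + d -> b <= a + d ->
    `|Num.max 0 a - Num.max 0 b| <= d.
  by move=> ab ba; rewrite ler_norml; case: (leP 0 a); case: (leP 0 b); lra.
by apply: h; lra.
Qed.

Lemma bump_out k x : ~ dyadic_cube k x -> bump k x = 0.
Proof.
move=> nkx; rewrite /bump (max_l _) ?mulr0// subr_le0 leNgt.
by apply/negP => H; apply: nkx; apply/cube_norm.
Qed.

Lemma bump_le_height k x : bump k x <= height k.
Proof.
rewrite ger_pMr ?height_gt0// ge_max ler01/=.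
have := side_le1 k; have := side_gt0 k; have := normr_ge0 (x - center k); lra.
Qed.

Lemma center0 k : center k 0 ord0 = 3 / 2 * side k.
Proof. by rewrite !mxE/= mulr1. Qed.

Lemma dyadic_cube_coord k x : dyadic_cube k x ->
  side k < x 0 ord0 /\ x 0 ord0 < 2 * side k.
Proof.
move=> /(_ ord0); rewrite center0 ltr_norml => /andP[]; lra.
Qed.

Lemma dyadic_cube_disjoint j k x : dyadic_cube j x -> dyadic_cube k x -> j = k.
Proof.
suff H i m y : (i < m)%N -> dyadic_cube i y -> dyadic_cube m y -> False.
  by move=> jx kx; case: (ltngtP j k) => // jk; exfalso; [exact: H jx kx|exact: H kx jx].
move=> im /dyadic_cube_coord[iy _] /dyadic_cube_coord[_ my].
have : side m <= side i / 2.
  rewrite /side -[X in _ <= _ * X]expr1 -exprD addn1.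
  by apply: ler_wiXn2l; rewrite ?invr_ge0// invf_le1// ler1n.
lra.
Qed.

(** The only index of a cube that contains x; the default value 0 is harmless since
    bumps and indicators vanish at points outside all the cubes. *)
Definition cube_index x : nat := xget 0%N [set k | dyadic_cube k x].

Lemma cube_index_out k x : k <> cube_index x -> ~ dyadic_cube k x.
Proof.
move=> kx ckx; apply: kx; apply: (dyadic_cube_disjoint ckx).
exact: (@xgetI _ 0%N [set j | dyadic_cube j x] k ckx).
Qed.

Lemma dyadic_series (u : nat -> \bar R) x : (forall k, 0 <= u k)%E ->
  (forall k, ~ dyadic_cube k x -> u k = 0%E) ->
  (\sum_(k <oo) u k)%E = u (cube_index x).
Proof.
move=> u0 ux; rewrite (@nneseriesD1 _ u (cube_index x))// eseries0 ?adde0// => k _ kx.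
by apply: ux; apply: cube_index_out; exact/eqP.
Qed.

Lemma dyadic_sum (u : nat -> R) x N : (cube_index x < N)%N ->
  (forall k, ~ dyadic_cube k x -> u k = 0) ->
  \sum_(k < N) u k = u (cube_index x).
Proof.
move=> xN ux; rewrite (bigD1 (Ordinal xN))//= big1 ?addr0// => k kx.
by apply: ux; apply: cube_index_out => e; move/eqP: kx; apply; exact/val_inj.
Qed.

Definition comb x : R := bump (cube_index x) x.

Definition comb_gradient x : \bar R :=
  (\sum_(k <oo) (height k * \1_(dyadic_cube k) x)%:E)%E.

Lemma measurable_dyadic_cube k :
  measurable (dyadic_cube k : set (borel_rV R n.+1)).
Proof. exact: measurable_cube. Qed.

Lemma height_indic_ge0 k x : (0 <= (height k * \1_(dyadic_cube k) x)%:E)%E.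
Proof. by rewrite lee_fin mulr_ge0// ltW// height_gt0. Qed.

Lemma comb_gradientE x : comb_gradient x =
  (height (cube_index x) * \1_(dyadic_cube (cube_index x)) x)%:E.
Proof.
rewrite /comb_gradient.
rewrite (@dyadic_series (fun k => (height k * \1_(dyadic_cube k) x)%:E) x)// => k.
  exact: height_indic_ge0.
by move=> kx; rewrite indicE memNset// mulr0.
Qed.

Lemma borel_nonneg_comb_gradient : borel_nonneg comb_gradient.
Proof.
split=> [|x]; last by rewrite comb_gradientE height_indic_ge0.
apply: ge0_emeasurable_sum => [k x _ _|k _]; first exact: height_indic_ge0.
apply/measurable_EFinP; apply: measurable_funM => //.
by apply: measurable_indic; exact: measurable_dyadic_cube.
Qed.

Lemma continuous_dist_center k : continuous (fun x : X => `|x - center k|).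
Proof.
move=> x; apply: (@continuous_comp _ _ _ (fun x : X => x - center k)
  (fun x : X => `|x|)).
  apply: (@continuousB _ _ _ id (fun=> center k)); last exact: cst_continuous.
  by move=> A.
exact: norm_continuous.
Qed.

Lemma measurable_bump k : measurable_fun setT (bump k : borel_rV R n.+1 -> R).
Proof.
apply: measurable_funM => //; apply: measurable_maxr => //.
apply: measurable_funB => //; apply: continuous_rV_borel.
exact: continuous_dist_center.
Qed.

Lemma measurable_comb : measurable_fun setT (comb : borel_rV R n.+1 -> R).
Proof.
apply/measurable_EFinP.
rewrite (_ : EFin \o comb = fun x => \sum_(k <oo) (bump k x)%:E)%E; last first.
  apply/funext => x; rewrite (@dyadic_series (fun k => (bump k x)%:E) x)//.
    by move=> k; rewrite lee_fin bump_ge0.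
  by move=> k kx; rewrite bump_out.
apply: ge0_emeasurable_sum => [k x _ _|k _]; first by rewrite lee_fin bump_ge0.
by apply/measurable_EFinP; exact: measurable_bump.
Qed.

Lemma comb_le_gradient x : (`|comb x|%:E <= comb_gradient x)%E.
Proof.
rewrite comb_gradientE lee_fin ger0_norm ?bump_ge0// /comb.
have [kx|kx] := pselect (dyadic_cube (cube_index x) x).
  by rewrite indicE mem_set// mulr1 bump_le_height.
by rewrite bump_out// mulr_ge0// ltW// height_gt0.
Qed.

Lemma measurable_curve_indic (c : rcurve R n.+1) k :
  measurable_fun `[0, rcurve_len c] (fun t : RT => (\1_(dyadic_cube k) (c t) : R)).
Proof.
rewrite (_ : (fun t => _) = \1_(`]-oo, (side k / 2)[%classic) \o
    (fun t : RT => `|c t - center k|)); last first.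
  apply/funext => t; rewrite /= !indicE; congr (_%:R); congr nat_of_bool.
  apply/idP/idP; rewrite !inE /= in_itv/=; first by move/cube_norm.
  by move=> ?; apply/cube_norm.
apply: measurableT_comp => //.
apply: subspace_continuous_measurable_fun; first exact: measurable_itv.
move=> t; exact: (@continuous_comp (subspace `[0, rcurve_len c]) X R c
  (fun x : X => `|x - center k|) t (@rcurve_continuous _ _ c t)
  (@continuous_dist_center k (c t))).
Qed.

(** Each bump, composed with a curve, is Lipschitz in the arc length and vanishes
    while the curve is outside of its cube, so that height * indicator bounds its
    increment; only finitely many bumps see the two endpoints. *)
Lemma comb_upper_gradient (c : rcurve R n.+1) :
  (`|comb (c 0) - comb (c (rcurve_len c))|%:E <= line_integral c comb_gradient)%E.
Proof.
set l := rcurve_len c; have l0 : 0 <= l := rcurve_len_ge0 c.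
pose N := (maxn (cube_index (c 0%R)) (cube_index (c l))).+1.
have combE x : (cube_index x < N)%N -> comb x = \sum_(k < N) bump k x.
  by move=> xN; rewrite (dyadic_sum (u := bump^~ x) xN)// => k; exact: bump_out.
rewrite !combE ?ltnS ?leq_maxl ?leq_maxr// -sumrB.
apply: (@le_trans _ _ (\sum_(k < N) `|bump k (c 0%R) - bump k (c l)|%:E)%E).
  by rewrite sumEFin lee_fin ler_norm_sum.
have mk k : measurable_fun (`[0, l]%classic : set RT)
    (fun t : RT => (height k * \1_(dyadic_cube k) (c t))%:E).
  apply/measurable_EFinP; apply: measurable_funM => //.
  exact: measurable_curve_indic.
rewrite /line_integral /comb_gradient integral_nneseries//; last first.
  by move=> k t _; exact: height_indic_ge0.
apply: (@le_trans _ _ (\sum_(0 <= k < N) \int[lebesgue_measure]_(t in `[0%R, l])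
    (height k * \1_(dyadic_cube k) (c t))%:E)%E); last first.
  by apply: nneseries_lim_ge => k _ _; apply: integral_ge0 => t _; exact: height_indic_ge0.
rewrite big_mkord; apply: lee_sum => k _.
have lip s t : s \in `[0, l] -> t \in `[0, l] ->
    `|bump k (c s) - bump k (c t)| <= height k * `|s - t|.
  move=> sl tl; apply: le_trans (bump_lipschitz _ _ _) _.
  rewrite ler_pM2l ?height_gt0//; apply: le_trans (norm_le_edist _ _) _.
  exact: rcurve_lipschitz.
apply: (lipschitz_integral_support l0 (height_gt0 k) lip (mk k)
  (fun t => height_indic_ge0 k (c t))).
move=> t tl nz; rewrite lee_fin indicE mem_set ?mulr1//.
by apply: contrapT => /(bump_out) /eqP; apply/negP.
Qed.

End dyadic_bumps.

(** * Finiteness of the Newton-Morrey norm *)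

Lemma integral_series_indic d (T : measurableType d) (R : realType)
    (mu : {measure set T -> \bar R}) (B : set T) (E : nat -> set T) (a : nat -> R) :
  measurable B -> (forall k, measurable (E k)) -> (forall k, 0 <= a k) ->
  (\int[mu]_(y in B) (\sum_(k <oo) (a k * \1_(E k) y)%:E) =
   \sum_(k <oo) (a k)%:E * mu (E k `&` B))%E.
Proof.
move=> mB mE a0; rewrite integral_nneseries//.
- apply: eq_eseriesr => k _; under eq_integral do rewrite EFinM.
  rewrite ge0_integralZl//; first by rewrite integral_indic.
  - by apply/measurable_EFinP; exact: measurable_indic.
  - by rewrite lee_fin.
- move=> k; apply/measurable_EFinP; exact: measurable_funM.
- by move=> k y _; rewrite lee_fin mulr_ge0.
Qed.

Lemma integral_pow_le d (T : measurableType d) (R : realType)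
    (mu : {measure set T -> \bar R}) (B : set T) (f g : T -> \bar R) (p : R) :
  0 <= p -> measurable B -> measurable_fun B f -> measurable_fun B g ->
  (forall y, `|f y| <= `|g y|)%E ->
  (\int[mu]_(y in B) poweR `|f y| p <= \int[mu]_(y in B) poweR `|g y| p)%E.
Proof.
move=> p0 mB mf mg fg; apply: ge0_le_integral => //.
- by move=> y _; exact: poweR_ge0.
- apply: (measurableT_comp (measurable_poweR p)); exact: measurableT_comp.
- apply: (measurableT_comp (measurable_poweR p)); exact: measurableT_comp.
- by move=> y _; apply: gt0_ler_poweR; rewrite ?in_itv/= ?leey ?abse_ge0.
Qed.

Section comb_in_NM.
Context (R : realType) (n : nat) (p q : R).
Hypotheses (p1 : 1 < p) (pq : p < q).
Local Notation X := 'rV[R]_n.+1.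
Local Notation comb := (@comb R n q).
Local Notation comb_gradient := (@comb_gradient R n q).
Local Notation height := (@height R n q).
Local Notation dyadic_cube := (@dyadic_cube R n).
Local Notation side := (side R).

Let p0 : 0 < p. Proof. exact: lt_trans p1. Qed.
Let q0 : 0 < q. Proof. exact: lt_trans pq. Qed.

Lemma lebesgue_n_dyadic_cube k :
  lebesgue_n R n.+1 (dyadic_cube k) = (side k ^+ n.+1)%:E.
Proof.
rewrite lebesgue_n_cube; last by rewrite divr_ge0// ltW// side_gt0.
by congr (_ ^+ _)%:E; rewrite mulr2n -splitr.
Qed.

Lemma sideX k : side k ^+ n.+1 = (2^-1 ^+ n.+1) ^+ k.
Proof. by rewrite /side -!exprM mulnC. Qed.

Lemma powR_exprn (x s : R) k : 0 <= x -> (x ^+ k) `^ s = (x `^ s) ^+ k.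
Proof.
move=> x0; elim: k => [|k IH]; first by rewrite !expr0 powR1.
by rewrite !exprS powRM ?exprn_ge0// IH.
Qed.

Lemma height_powR k : height k `^ p = ((2^-1 ^+ n.+1) `^ (- (p / q))) ^+ k.
Proof.
rewrite /height sideX -powRrM powR_exprn ?exprn_ge0 ?invr_ge0//.
by congr ((_ `^ _) ^+ _); rewrite mulNr mulrC.
Qed.

(** By disjointness the p-th power acts on each height separately; the
    intersection of the k-th cube with B has measure at most w and at most the
    volume of the cube, which leads to the truncated geometric sum. *)
Lemma integral_comb_gradient_pow : exists2 K : R, 0 < K &
  forall (B : set X) (w : R), measurable (B : set (borel_rV R n.+1)) -> 0 < w ->
    lebesgue_n R n.+1 B = w%:E ->
    (\int[@lebesgue_n R n.+1]_(y in B) poweR `|comb_gradient y| p <=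
     (K * w `^ (1 - p / q))%:E)%E.
Proof.
have x0 : 0 < (2^-1 : R) ^+ n.+1 by rewrite exprn_gt0// invr_gt0.
have x1 : (2^-1 : R) ^+ n.+1 < 1 by rewrite exprn_ilt1// ?invr_ge0// invf_lt1// ltr1n.
have th0 : 0 < p / q by rewrite divr_gt0.
have th1 : p / q < 1 by rewrite ltr_pdivrMr// mul1r.
have [K K0 HK] := truncated_geometric_sum x0 x1 th0 th1.
exists K => // B w mB w0 wE.
have -> : (fun y : X => poweR `|comb_gradient y| p) =
    fun y => (\sum_(k <oo) (height k `^ p * \1_(dyadic_cube k) y)%:E)%E.
  apply/funext => y.
  rewrite (@dyadic_series R n (fun k => (height k `^ p * \1_(dyadic_cube k) y)%:E) y).
  - rewrite comb_gradientE gee0_abs ?height_indic_ge0// poweR_EFin powRM//.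
      congr (_ * _)%:E; rewrite indicE; case: (_ \in _); first by rewrite powR1.
      by rewrite powR0// gt_eqF.
    exact/ltW/height_gt0.
  - by move=> k; rewrite lee_fin mulr_ge0// powR_ge0.
  - by move=> k ky; rewrite indicE memNset// mulr0.
have mC k := borel_lebesgue_measurable (@measurable_dyadic_cube R n k).
rewrite (integral_series_indic _ (borel_lebesgue_measurable mB) mC); last first.
  by move=> k; exact: powR_ge0.
have ub k : ((height k `^ p)%:E * lebesgue_n R n.+1 (dyadic_cube k `&` B) <=
    (((2^-1 ^+ n.+1) `^ (- (p / q))) ^+ k * Num.min w ((2^-1 ^+ n.+1) ^+ k))%:E)%E.
  rewrite height_powR EFinM; apply: lee_wpmul2l.
    by rewrite lee_fin exprn_ge0// powR_ge0.
  have mCB : measurable (dyadic_cube k `&` B : set (lebesgue_rV R n.+1)).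
    by apply: measurableI; [exact: mC|exact: borel_lebesgue_measurable].
  rewrite EFin_min le_min; apply/andP; split.
    rewrite -wE; apply: le_measure; rewrite ?inE; [exact: mCB| |exact: subIsetr].
    exact: borel_lebesgue_measurable.
  rewrite -sideX -lebesgue_n_dyadic_cube.
  apply: le_measure; rewrite ?inE; [exact: mCB|exact: mC|exact: subIsetl].
apply: lime_le.
  apply: is_cvg_nneseries => k _ _.
  by rewrite mule_ge0// lee_fin powR_ge0.
near=> N.
apply: (@le_trans _ _ (\sum_(0 <= k < N)
   (((2^-1 ^+ n.+1) `^ (- (p / q))) ^+ k * Num.min w ((2^-1 ^+ n.+1) ^+ k))%:E)%E).
  by apply: lee_sum => k _; exact: ub.
by rewrite big_mkord sumEFin lee_fin; exact: HK.
Unshelve. all: by end_near. Qed.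

Lemma morrey_norm_comb_le : exists K : R, forall u : X -> \bar R,
  measurable_fun setT (u : borel_rV R n.+1 -> \bar R) ->
  (forall y, `|u y| <= comb_gradient y)%E ->
  (morrey_norm p q u <= K%:E)%E.
Proof.
have [K K0 HK] := integral_comb_gradient_pow.
have [mg g0] := borel_nonneg_comb_gradient n q.
exists (K `^ p^-1) => u mu ug; apply: ge_ereal_sup => _ [x _ [r /= r0] <-].
have [w [w0 _ wE]] := lebesgue_n_eball x r0.
have mB := measurable_eball x r.
have mtoL (v : X -> \bar R) : measurable_fun setT (v : borel_rV R n.+1 -> \bar R) ->
    measurable_fun (eball x r : set (lebesgue_rV R n.+1)) v.
  move=> mv; apply: measurable_funTS => /= _ A mA.
  rewrite setTI; apply: borel_lebesgue_measurable.
  by rewrite -[X in measurable X]setTI; exact: mv.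
have I1 : (\int[@lebesgue_n R n.+1]_(y in eball x r) poweR `|u y| p <=
    (K * w `^ (1 - p / q))%:E)%E.
  apply: le_trans (HK _ _ mB w0 wE).
  apply: (integral_pow_le _ (ltW p0) (borel_lebesgue_measurable mB) (mtoL _ mu) (mtoL _ mg)).
  by move=> y; rewrite (gee0_abs (g0 y)).
rewrite wE poweR_EFin.
have -> : K `^ p^-1 = w `^ (q^-1 - p^-1) * (K * w `^ (1 - p / q)) `^ p^-1.
  rewrite powRM ?powR_ge0 ?(ltW K0)// mulrCA -powRrM -powRD ?(gt_eqF w0) ?implybT//.
  rewrite (_ : q^-1 - p^-1 + _ = 0) ?powRr0 ?mulr1//.
  by field; rewrite !gt_eqF.
rewrite EFinM; apply: lee_wpmul2l; first by rewrite lee_fin powR_ge0.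
rewrite -poweR_EFin; apply: gt0_ler_poweR; rewrite ?in_itv/= ?leey ?andbT//.
- by rewrite invr_ge0 ltW.
- by apply: integral_ge0 => y _; exact: poweR_ge0.
- by rewrite lee_fin mulr_ge0 ?(ltW K0) ?powR_ge0.
Qed.

Lemma morrey_modulus0 : morrey_modulus p q (@set0 (rcurve R n.+1)) = 0%E.
Proof.
apply/eqP; rewrite eq_le; apply/andP; split.
  apply: ereal_inf_lbound; exists (cst 0%E).
    by split=> //; split => //; exact: measurable_cst.
  rewrite (_ : morrey_norm p q (cst 0%E) = 0%E) ?poweR0r ?gt_eqF//.
  apply/eqP; rewrite eq_le morrey_norm_ge0 andbT.
  apply: ge_ereal_sup => _ [x _ [r /= r0] <-].
  have -> : (fun y : X => poweR `|cst 0%E y| p) = cst (0%E : \bar R).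
    apply/funext => y. rewrite /cst abse0 poweR0r ?gt_eqF//. 
  by rewrite integral0 poweR0r ?mule0// gt_eqF// invr_gt0.
by apply: le_ereal_inf_tmp => _ [rho _ <-]; exact: poweR_ge0.
Qed.

Lemma comb_preNM : preNM p q comb.
Proof.
have [K HK] := morrey_norm_comb_le.
have mc := @measurable_comb R n q.
split.
  move=> _ A mA; rewrite setTI; apply: borel_lebesgue_measurable.
  by rewrite -[X in measurable X]setTI; exact: mc.
have [mg g0] := borel_nonneg_comb_gradient n q.
apply: (@le_lt_trans _ _ (K%:E + K%:E)%E); last by rewrite -EFinD ltry.
apply: leeD.
  apply: HK; first exact/measurable_EFinP.
  by move=> y; exact: comb_le_gradient.
apply: (@le_trans _ _ (morrey_norm p q comb_gradient)).
  apply: ereal_inf_lbound; exists comb_gradient => //.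
  split; first exact: borel_nonneg_comb_gradient.
  exists set0; first exact: morrey_modulus0.
  by move=> c _ _; exact: comb_upper_gradient.
by apply: HK => // y; rewrite gee0_abs.
Qed.

End comb_in_NM.

(** * Distance to functions of bounded slope *)

Section directional_lipschitz.
Context (R : realType) (n : nat).
Local Notation X := 'rV[R]_n.+1.
Local Notation e1 := (delta_mx 0 ord0 : X).

(** What C^1 and Lipschitz functions have in common at the point 0, where the
    cubes accumulate; it contradicts the unbounded slopes of [comb]. *)
Definition e1_lipschitz_near0 (g : X -> R) : Prop :=
  exists L d : R, 0 < d /\ forall (x : X) (t : R), `|x| < d -> 0 <= t -> t < d ->
    `|g (t *: e1 + x) - g x| <= L * t.

Lemma Lipschitz_e1_lipschitz (g : X -> R) :
  Lipschitz_function g -> e1_lipschitz_near0 g.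
Proof.
move=> [L Lg]; exists L, 1; split=> // x t _ t0 _.
rewrite (le_trans (Lg _ _))// le_eqVlt; apply/orP; left; apply/eqP; congr (_ * _).
rewrite /edist big_ord_recl big1 => [|i _].
  by rewrite addr0 !mxE/= mulr1 addrK sqrtr_sqr ger0_norm.
by rewrite !mxE/= mulr0 add0r subrr expr0n.
Qed.

Lemma is_derive_e1 (g : X -> R) (x : X) (t : R) : derivable g (t *: e1 + x) e1 ->
  is_derive t (1 : R) (fun s : R => g (s *: e1 + x)) ('D_e1 g (t *: e1 + x)).
Proof.
move=> dg.
have E : (fun h : R => h^-1 *: (((fun s : R => g (s *: e1 + x)) \o shift t) (h *: (1 : R))
    - g (t *: e1 + x))) =
  (fun h : R => h^-1 *: ((g \o shift (t *: e1 + x)) (h *: e1) - g (t *: e1 + x))).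
  apply/funext => h; rewrite /= /shift /=; congr (_ *: (g _ - _)).
  by rewrite [h *: 1]mulr1 scalerDl addrA.
by split; rewrite /derivable /derive /= E.
Qed.

(** Mean value theorem; continuity at 0 of the first partial derivative bounds it
    near 0. *)
Lemma C1_e1_lipschitz (g : X -> R) : C1_function g -> e1_lipschitz_near0 g.
Proof.
move=> [cg /(_ ord0)[dg cDg]].
have /cvgrPdist_lt /(_ 1 ltr01) /nbhs_normP[d /= d0 Hd] := cDg 0.
pose M := `|'D_e1 g 0| + 1.
have DM (z : X) : `|z| < d -> `|'D_e1 g z| <= M.
  move=> zd; have /= := Hd z; rewrite /ball_/= sub0r normrN => /(_ zd) H.
  rewrite /M -lerBlDl (le_trans _ (ltW H))// distrC.
  by rewrite (le_trans _ (lerB_dist _ _))//.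
exists M, (d / 2); split=> [|x t xd t0 td]; first by rewrite divr_gt0.
move: t0; rewrite le_eqVlt => /predU1P[<-|t0].
  by rewrite scale0r add0r subrr normr0 mulr0.
have e1n : `|e1| <= 1.
  rewrite [leLHS]mx_normrE; apply: bigmax_le => // -[i j] _ /=.
  by rewrite ord1 !mxE/=; case: (j == ord0); rewrite ?normr1 ?normr0.
have [|c] := @MVT _ (fun s : R => g (s *: e1 + x))
  (fun s => 'D_e1 g (s *: e1 + x)) 0 t t0 (fun s _ => is_derive_e1 (dg _)).
  apply: continuous_subspaceT => s; apply: differentiable_continuous.
  by apply/derivable1_diffP; case: (is_derive_e1 (dg (s *: e1 + x))).
rewrite in_itv/= => /andP[c0 ct]; rewrite scale0r add0r subr0 => ->.
rewrite normrM (gtr0_norm t0) ler_pM2r//; apply: DM.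
rewrite (le_lt_trans (ler_normD _ _))// normrZ (gtr0_norm c0).
have : c * `|e1| <= c by rewrite ger_pMr.
lra.
Qed.

End directional_lipschitz.

Section not_dense.
Context (R : realType) (n : nat) (p q : R).
Hypotheses (p1 : 1 < p) (pq : p < q).
Local Notation X := 'rV[R]_n.+1.
Local Notation comb := (@comb R n q).
Local Notation height := (@height R n q).
Local Notation side := (side R).
Let RT := measurableTypeR R.

Let q0 : 0 < q. Proof. exact: lt_trans (lt_trans _ p1) pq. Qed.

Lemma exists_small_scale (M d : R) : 0 < d ->
  exists k, side k < d /\ M < height k.
Proof.
move=> d0.
have b1 : (2^-1 ^+ n.+1 : R) `^ q^-1 < 1.
  have one_powR : 1 = 1 `^ q^-1 :> R by rewrite powR1.
  rewrite [ltRHS]one_powR.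
  apply: gt0_ltr_powR; rewrite ?invr_gt0 ?nnegrE ?ler01 ?exprn_ge0 ?invr_ge0//.
  by rewrite exprn_ilt1// ?invr_ge0// invf_lt1// ltr1n.
have b0 : 0 < (2^-1 ^+ n.+1 : R) `^ q^-1.
  by rewrite powR_gt0// exprn_gt0// invr_gt0.
have h1 : \forall k \near \oo, side k < d.
  have /cvgrPdist_lt /(_ d d0) : (side k @[k --> \oo] --> (0 : R)).
    by apply: cvg_expr; rewrite ger0_norm ?invr_ge0// invf_lt1// ltr1n.
  by apply: filterS => k; rewrite sub0r normrN gtr0_norm// side_gt0.
pose M' := `|M| + 1.
have M'0 : 0 < M' by rewrite ltr_wpDl.
have h2 : \forall k \near \oo, ((2^-1 ^+ n.+1 : R) `^ q^-1) ^+ k < M'^-1.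
  have /cvgrPdist_lt /(_ M'^-1) : ((((2^-1 ^+ n.+1 : R) `^ q^-1) ^+ k) @[k --> \oo] --> (0 : R)).
    by apply: cvg_expr; rewrite gtr0_norm.
  rewrite invr_gt0 => /(_ M'0); apply: filterS => k.
  by rewrite sub0r normrN ger0_norm// exprn_ge0// ltW.
near \oo => k; exists k; split; first by near: k.
apply: (@lt_le_trans _ _ M'); first by rewrite /M' (le_lt_trans (ler_norm _))// ltrDl.
rewrite /height powRN sideX powR_exprn ?exprn_ge0 ?invr_ge0//.
rewrite -[leLHS]invrK lef_pV2 ?posrE ?invr_gt0 ?exprn_gt0//.
by apply: ltW; near: k.
Unshelve. all: by end_near. Qed.

Lemma comb_hline0 y : comb (hline y 0) = 0.
Proof.
rewrite /comb bump_out// => /dyadic_cube_coord[]; rewrite hline0.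
by have := @side_gt0 R (cube_index (hline y 0)); lra.
Qed.

(** The segment over such a y runs from the hyperplane t = 0, where comb vanishes,
    to a point close to the centre of the k-th cube. *)
Definition cross_section k : set (n.-tuple RT) :=
  @rV_of_tuple R n @^-1` cube 0 (side k / 4).

Lemma comb_hline_ge k y : cross_section k y ->
  height k * (side k / 4) <= comb (hline y (3 / 2 * side k)).
Proof.
move=> yk; have s0 := @side_gt0 R k.
have le4 : `|hline y (3 / 2 * side k) - center R n k| <= side k / 4.
  rewrite [leLHS]mx_normrE; apply: bigmax_le => [|[i j] _ /=]; first by lra.
  rewrite ord1 !mxE; have [j' ->|->] := unliftP ord0 j.
    have := yk j'; rewrite !mxE tnthS subr0 => /ltW.
    by rewrite /= mulr0 subr0.
  by rewrite /= mulr1 subrr normr0; lra.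
have inC : dyadic_cube k (hline y (3 / 2 * side k)).
  by apply/cube_norm; apply: le_lt_trans le4 _; lra.
have -> : comb (hline y (3 / 2 * side k)) = bump q k (hline y (3 / 2 * side k)).
  rewrite /comb; congr bump; apply/esym; apply: contrapT => kx.
  exact: (cube_index_out kx inC).
rewrite /bump ler_pM2l ?height_gt0// le_max; apply/orP; right; lra.
Qed.

Lemma hline_in_eball k y t : cross_section k y -> t \in `[0, 3 / 2 * side k] ->
  eball 0 (2 * n.+1%:R * side k) (hline y t).
Proof.
move=> yk; rewrite in_itv/= => /andP[t0 tl]; have s0 := @side_gt0 R k.
apply: (@le_lt_trans _ _ (n.+1%:R * (3 / 2 * side k))).
  apply: edist_le => [i|]; last by lra.
  rewrite mxE sub0r normrN; have [j ->|->] := unliftP ord0 i.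
    rewrite hlineS; have := yk j; rewrite !mxE subr0; lra.
  by rewrite hline0 ger0_norm.
rewrite [ltRHS](_ : _ = n.+1%:R * (2 * side k)); last by ring.
by rewrite ltr_pM2l//; lra.
Qed.

Lemma cross_section_measure k :
  lebesgue_tuple R n (cross_section k) = ((side k / 2) ^+ n)%:E.
Proof.
rewrite /cross_section lebesgue_tuple_cube; last by have := @side_gt0 R k; lra.
by congr (_ ^+ _)%:E; rewrite mulr2n; field.
Qed.

Lemma norm_hline0_le k y : cross_section k y -> `|hline y 0| <= side k / 4.
Proof.
have s0 := @side_gt0 R k.
move=> yk; rewrite [leLHS]mx_normrE; apply: bigmax_le => [|[i j] _ /=]; first by lra.
rewrite ord1; have [j' ->|->] := unliftP ord0 j.
  by rewrite hlineS; have := yk j'; rewrite !mxE subr0 => /ltW.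
by rewrite hline0 normr0; lra.
Qed.

(** If [comb] were within e of the class of g, the difference comb - g would be a
    sum of four functions of norm less than e: one is the difference f' - h of the
    representatives that realize the distance, one leads from comb to f', and two
    lead from h to g through the function f0 that defines their class. On
    the segments of scale k the increment of comb is at least 2 m, that of g at
    most m, hence m |Q| <= 16 e w^(1-1/q), with w comparable to the volume V of
    the k-th cube. Both sides scale like V^(1-1/q), so that e cannot be small. *)
Lemma not_dense (C : set (X -> R)) : (forall g, C g -> e1_lipschitz_near0 g) ->
  ~ NM_dense p q (NM_having p q C).
Proof.
move=> CL dense.
(* A0 V bounds the volume of the ball that contains the test segments *)
pose A0 : R := (4 * n.+1%:R) ^+ n.+1.
have A01 : 1 <= A0 by rewrite exprn_ege1// -natrM ler1n.
have A00 : 0 < A0 := lt_le_trans ltr01 A01.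
(* 256 = 2 * 8 * 16: four certificates of size 4 e, the denominator 8 of m, and a
   factor 2 to make the inequality strict *)
pose e := (256 * 2 ^+ n * A0)^-1.
have twon : 0 < (2 : R) ^+ n by rewrite exprn_gt0.
have e0 : 0 < e by rewrite invr_gt0 !mulr_gt0.
have NMcomb : NM p q (NM_class p q comb).
  by exists comb; first exact: comb_preNM.
have [B [[f0 f0N <-] [g [gN fg0] Cg]]] := dense _ NMcomb e e0.
move=> /ereal_inf_lt[_ [f' [f'N ff'0] [h [hN fh0] <-]] f'he].
have [L [d [d0 gL]]] := CL g Cg.
have d20 : 0 < d / 2 by rewrite divr_gt0.
have [k [sd Lk]] := exists_small_scale (12 * L) d20.
have s0 := @side_gt0 R k; have H0 := @height_gt0 R n q k.
set s := side k in sd s0; pose l := 3 / 2 * s.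
have l0 : 0 < l by rewrite /l; lra.
pose m := height k * s / 8.
have m0 : 0 < m by rewrite /m; rewrite !mulr_gt0.
pose r := 2 * n.+1%:R * s.
have r0 : 0 < r by rewrite !mulr_gt0.
have [w [w0 wle wE]] := @lebesgue_n_eball R n.+1 0 r r0.
have ob (u : X -> R) : (preNM_norm p q u < e%:E)%E ->
    osc_bound (eball 0 r) l m u (4 * e * w `^ (1 - q^-1)).
  exact: (osc_bound_preNM p1 pq r0 e0 w0 l0 m0 wE).
have mB := measurable_eball (0 : X) r.
have o1 : osc_bound (eball 0 r) l m (comb \- f') (4 * e * w `^ (1 - q^-1)).
  by apply: ob; rewrite ff'0.
have o2 := ob _ f'he.
have o3 : osc_bound (eball 0 r) l m (f0 \- h) (4 * e * w `^ (1 - q^-1)).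
  by apply: ob; rewrite fh0.
have o4 : osc_bound (eball 0 r) l m (f0 \- g) (4 * e * w `^ (1 - q^-1)).
  by apply: ob; rewrite fg0.
(* comb - g = (comb - f') + (f' - h) + (- (f0 - h) + (f0 - g)) *)
have := osc_boundD mB (ltW m0) (osc_boundD mB (ltW m0) o1 o2)
  (osc_boundD mB (ltW m0) (osc_boundN o3) o4).
set u := (fun x => _ : R) => ou.
have uE x : u x = comb x - g x by rewrite /u /=; ring.
have mQ : measurable (cross_section k).
  exact: (measurable_rV_of_tuple_preimage (@measurable_cube R n 0 (s / 4))).
have QB y t : cross_section k y -> t \in `[0, l] -> eball 0 r (hline y t).
  exact: hline_in_eball.
have Qu y : cross_section k y -> m <= `|u (hline y 0) - u (hline y l)|.
  move=> yk; rewrite !uE comb_hline0.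
  have xd : `|hline y 0| < d by have := norm_hline0_le yk; rewrite -/s; lra.
  have := gL _ l xd (ltW l0) _; rewrite -hlineD add0r => /(_ ltac:(rewrite /l; lra)).
  have := comb_hline_ge yk; rewrite -/s -/l.
  move: (comb _) (g _) (g _) => F g1 g0 F4 gl.
  have lE : l = 3 / 2 * s by [].
  have Ls : L * l <= m.
    have : (12 * L) * s <= height k * s by rewrite ler_pM2r// ltW.
    rewrite lE /m; lra.
  have F4' : 2 * m <= F by rewrite /m; lra.
  have := ler_norm (F - (g1 - g0)).
  rewrite -normrN opprB sub0r => H; move: gl; rewrite ler_norml => /andP[gl1 gl2].
  rewrite ler_normr; apply/orP; right; lra.
have vE : lebesgue_tuple R n (cross_section k) = ((s / 2) ^+ n)%:E.
  exact: cross_section_measure.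
have := osc_bound_le mB mQ (ltW m0) QB Qu vE ou.
apply/negP; rewrite -ltNge.
set W := w `^ (1 - q^-1).
pose V := s ^+ n.+1.
have V0 : 0 < V by rewrite exprn_gt0.
have iq : 0 < 1 - q^-1.
  by rewrite subr_gt0 invf_lt1// (lt_trans p1).
have WV : W <= A0 * V `^ (1 - q^-1).
  have wAV : w <= A0 * V.
    by rewrite (le_trans wle)// le_eqVlt -exprMn /r -mulr_natr; apply/orP; left;
      apply/eqP; congr (_ ^+ _); ring.
  apply: (@le_trans _ _ ((A0 * V) `^ (1 - q^-1))).
    apply: ge0_ler_powR; rewrite ?nnegrE//; [exact: ltW|exact: ltW|].
    by rewrite mulr_ge0 ?ltW.
  rewrite powRM ?(ltW A00) ?(ltW V0)// ler_pM2r ?powR_gt0//.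
  rewrite -[leRHS](powRr1 (ltW A00)); apply: ler_powR => //.
  by rewrite gerBl invr_ge0 ltW.
have HV : height k * V = V `^ (1 - q^-1).
  rewrite /height -/s -/V [1 - _]addrC powRD ?(gt_eqF V0) ?implybT//.
  by rewrite powRr1 ?ltW.
have mv : m * (s / 2) ^+ n = V `^ (1 - q^-1) / (8 * 2 ^+ n).
  rewrite -HV /m /V exprS expr_div_n; field.
  by rewrite gt_eqF.
rewrite mv; apply: (@le_lt_trans _ _ (16 * e * (A0 * V `^ (1 - q^-1)))).
  rewrite (_ : _ + _ = 16 * e * W); last by ring.
  by rewrite ler_pM2l// mulr_gt0.
have -> : 16 * e * (A0 * V `^ (1 - q^-1)) = V `^ (1 - q^-1) / (16 * 2 ^+ n).
  rewrite /e; field; by rewrite !gt_eqF.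
rewrite ltr_pM2l ?powR_gt0// ltf_pV2 ?posrE ?mulr_gt0// ltr_pM2r//.
by rewrite ltr_nat.
Qed.

End not_dense.

Theorem mainTheorem6 (R : realType) (n : nat) (p q : R) :
  (0 < n)%N -> 1 < p -> p < q ->
  ~ NM_dense p q (NM_having p q (@C1_function R n)) /\
  ~ NM_dense p q (NM_having p q (@Lipschitz_function R n)).
Proof.
case: n => // n _ p1 pq; split; apply: not_dense => // g.
  exact: C1_e1_lipschitz.
exact: Lipschitz_e1_lipschitz.
Qed.
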